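(* Let $\mathcal H_1$ act on an associative algebra $\mathcal A$ and let $\Omega\in\mathcal A$ satisfy $\delta_2'(a)=\Omega a-a\Omega$ for all $a\in\mathcal A$, $\delta_k(\Omega)=0$ for all $k\ge1$, and $Y(\Omega)=2\Omega$. Let $\gamma\in Z^1(\mathcal H_1,\mathcal A)$ be a $1$-cocycle such that $\gamma(X)=\gamma(Y)=0$ and $\delta_k(\gamma(h))=0$ for all $h\in\mathcal H_1$ and all $k\ge1$. Then the brackets $RC_n$, $n\ge0$, are invariant under the inner perturbation of the action of $\mathcal H_1$ associated to $\gamma$: the brackets computed from the perturbed action, with quadratic differential $\Omega+X(\mu)+\tfrac12\mu^2$ where $\mu=\gamma(\delta_1)$, coincide with those computed from the original action with quadratic differential $\Omega$.
   Context: Algebras are unital over $\mathbb C$. $\mathcal H_1$ is the Hopf algebra which as an algebra is the universal enveloping algebra of the Lie algebra with basis $\{X,Y,\delta_n;n\ge1\}$ and brackets $[Y,X]=X$, $[Y,\delta_n]=n\delta_n$, $[X,\delta_n]=\delta_{n+1}$, $[\delta_k,\delta_\ell]=0$; the coproduct is the algebra homomorphism with $\Delta Y=Y\otimes1+1\otimes Y$, $\Delta\delta_1=\delta_1\otimes1+1\otimes\delta_1$, $\Delta X=X\otimes1+1\otimes X+\delta_1\otimes Y$; the counit kills $X,Y,\delta_n$; $S(X)=-X+\delta_1Y$. Actions are module-algebra structures: $h(ab)=\sum h_{(1)}(a)h_{(2)}(b)$, $h(1)=\varepsilon(h)1$. $\delta_2':=\delta_2-\frac12\delta_1^2$. A $1$-cocycle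 $\gamma\in Z^1(\mathcal H_1,\mathcal A)$ is a convolution-invertible linear map $\gamma:\mathcal H_1\to\mathcal A$ with $\gamma(hh')=\sum\gamma(h_{(1)})\,h_{(2)}(\gamma(h'))$ for all $h,h'$. The associated inner perturbation is the new action $h\cdot a=\sum\gamma(h_{(1)})\,h_{(2)}(a)\,\gamma^{-1}(h_{(3)})$, $\gamma^{-1}$ being the convolution inverse. On generators here it is $Y\mapsto Y$, $X\mapsto X+L_\mu Y$, $\delta_1\mapsto\delta_1+L_\mu-R_\mu$, with $L_\mu,R_\mu$ left and right multiplication by $\mu$. Brackets of an action with quadratic differential $\Omega$: with $L_\Omega,R_\Omega$ left and right multiplication by $\Omega$, let $B_0=1$, $B_1=X$, $B_{n+1}=XB_n-n\,L_\Omega(Y-\frac{n-1}2)B_{n-1}$, and $A_0=1$, $A_1=S(X)$, $A_{n+1}=S(X)A_n-n\,R_\Omega(Y-\frac{n-1}2)A_{n-1}$; with $(\alpha)_k=\alpha(\alpha+1)\cdots(\alpha+k-1)$, $$RC_n(a,b)=\sum_{k=0}^n\Big(\frac{A_k}{k!}(2Y+k)_{n-k}\Big)(a)\Big(\frac{B_{n-k}}{(n-k)!}(2Y+n-k)_k\Big)(b).$$ *)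

(* Defs.v *)
From HB Require Import structures.
From mathcomp Require Import all_boot all_algebra.
From mathcomp Require Import boolp reals.

Set Implicit Arguments.
Unset Strict Implicit.
Unset Printing Implicit Defensive.

Import GRing.Theory.
Local Open Scope ring_scope.
Local Open Scope quotient_scope.

(* Tensor product of two vector spaces: formal sums of pairs, two of them being
   identified when no bilinear map can tell them apart; scalars are carried by
   the factors. *)
Section Tensor.
Variables (K : fieldType) (U V : lmodType K).

Definition bilin (W : lmodType K) (f : U -> V -> W) : Prop :=
  bilinear_for *:%R *:%R f.

Definition psum (W : lmodType K) (f : U -> V -> W) (s : seq (U * V)) : W :=
  \sum_(p <- s) f p.1 p.2.

Definition teq_prop (s t : seq (U * V)) : Prop :=
  forall (W : lmodType K) (f : U -> V -> W), bilin f -> psum f s = psum f t.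

Definition teq (s t : seq (U * V)) : bool := `[< teq_prop s t >].

Lemma teqP s t : reflect (teq_prop s t) (teq s t).
Proof. exact: asboolP. Qed.

Lemma teq_refl : reflexive teq.
Proof. by move=> s; apply/teqP. Qed.

Lemma teq_sym : symmetric teq.
Proof.
by move=> s t; apply/teqP/teqP => h W f bf; rewrite (h W f bf).
Qed.

Lemma teq_trans : transitive teq.
Proof.
move=> s t u /teqP h1 /teqP h2; apply/teqP => W f bf.
by rewrite (h1 W f bf) (h2 W f bf).
Qed.

Definition teq_equiv := EquivRel teq teq_refl teq_sym teq_trans.

Definition tensor := {eq_quot teq_equiv}.
HB.instance Definition _ := Choice.on tensor.
HB.instance Definition _ := EqQuotient.on tensor.

Definition tpure (u : U) (v : V) : tensor := \pi_tensor [:: (u, v)].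

(* For bilinear f, the linear map with tlift f (tpure u v) = f u v. *)
Definition tlift (W : lmodType K) (f : U -> V -> W) (x : tensor) : W :=
  psum f (repr x).

Lemma tensor_pi_eq s t : teq_prop s t -> \pi_tensor s = \pi_tensor t.
Proof. by move=> h; apply/(@eqmodP _ teq_equiv)/teqP. Qed.

Lemma tlift_pi (W : lmodType K) (f : U -> V -> W) s :
  bilin f -> tlift f (\pi_tensor s) = psum f s.
Proof.
move=> bf; have /teqP h : teq (repr (\pi_tensor s)) s.
  by apply/(@eqmodP _ teq_equiv); rewrite reprK.
exact: h.
Qed.

Lemma tensor_ext (x y : tensor) :
  (forall (W : lmodType K) (f : U -> V -> W), bilin f ->
     tlift f x = tlift f y) -> x = y.
Proof.
by move=> h; rewrite -[x]reprK -[y]reprK; apply: tensor_pi_eq => W f /(h W f).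
Qed.

Lemma bilinDl (W : lmodType K) (f : U -> V -> W) : bilin f ->
  forall u u' v, f (u + u') v = f u v + f u' v.
Proof. by move=> [h _] u u' v; have /= := h v 1 u u'; rewrite !scale1r. Qed.

Lemma bilinDr (W : lmodType K) (f : U -> V -> W) : bilin f ->
  forall u v v', f u (v + v') = f u v + f u v'.
Proof. by move=> [_ h] u v v'; have /= := h u 1 v v'; rewrite !scale1r. Qed.

Lemma bilin0l (W : lmodType K) (f : U -> V -> W) : bilin f ->
  forall v, f 0 v = 0.
Proof.
move=> bf v; apply: (addrI (f 0 v)).
by rewrite -(bilinDl bf) !addr0.
Qed.

Lemma bilin0r (W : lmodType K) (f : U -> V -> W) : bilin f ->
  forall u, f u 0 = 0.
Proof.
move=> bf u; apply: (addrI (f u 0)).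
by rewrite -(bilinDr bf) !addr0.
Qed.

Lemma bilinZl (W : lmodType K) (f : U -> V -> W) : bilin f ->
  forall c u v, f (c *: u) v = c *: f u v.
Proof.
by move=> bf c u v; have /= := bf.1 v c u 0; rewrite addr0 (bilin0l bf) addr0.
Qed.

Lemma bilinZr (W : lmodType K) (f : U -> V -> W) : bilin f ->
  forall c u v, f u (c *: v) = c *: f u v.
Proof.
by move=> bf c u v; have /= := bf.2 u c v 0; rewrite addr0 (bilin0r bf) addr0.
Qed.

Lemma tlift_pure (W : lmodType K) (f : U -> V -> W) u v :
  bilin f -> tlift f (tpure u v) = f u v.
Proof. by move=> bf; rewrite tlift_pi // /psum big_seq1. Qed.

Definition pscale (c : K) (s : seq (U * V)) := [seq (c *: p.1, p.2) | p <- s].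

Lemma psum_scale (W : lmodType K) (f : U -> V -> W) c s : bilin f ->
  psum f (pscale c s) = c *: psum f s.
Proof.
move=> bf; rewrite /psum big_map scaler_sumr.
by apply: eq_bigr => p _; rewrite (bilinZl bf).
Qed.

Lemma psum_cat (W : lmodType K) (f : U -> V -> W) s t :
  psum f (s ++ t) = psum f s + psum f t.
Proof. exact: big_cat. Qed.

Definition tadd (x y : tensor) : tensor := \pi_tensor (repr x ++ repr y).
Definition tzero : tensor := \pi_tensor [::].
Definition tscale (c : K) (x : tensor) : tensor :=
  \pi_tensor (pscale c (repr x)).
Definition topp (x : tensor) : tensor := tscale (-1) x.

Lemma tlift_add (W : lmodType K) (f : U -> V -> W) x y : bilin f ->
  tlift f (tadd x y) = tlift f x + tlift f y.
Proof. by move=> bf; rewrite tlift_pi // psum_cat. Qed.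

Lemma tlift_zero (W : lmodType K) (f : U -> V -> W) : bilin f ->
  tlift f tzero = 0.
Proof. by move=> bf; rewrite tlift_pi // /psum big_nil. Qed.

Lemma tlift_scale (W : lmodType K) (f : U -> V -> W) c x : bilin f ->
  tlift f (tscale c x) = c *: tlift f x.
Proof. by move=> bf; rewrite tlift_pi // psum_scale. Qed.

Lemma tlift_opp (W : lmodType K) (f : U -> V -> W) x : bilin f ->
  tlift f (topp x) = - tlift f x.
Proof. by move=> bf; rewrite tlift_scale // scaleN1r. Qed.

Lemma taddA : associative tadd.
Proof.
by move=> x y z; apply: tensor_ext => W f bf; rewrite !tlift_add // addrA.
Qed.

Lemma taddC : commutative tadd.
Proof.
by move=> x y; apply: tensor_ext => W f bf; rewrite !tlift_add // addrC.
Qed.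

Lemma tadd0 : left_id tzero tadd.
Proof.
by move=> x; apply: tensor_ext => W f bf; rewrite tlift_add // tlift_zero // add0r.
Qed.

Lemma taddN : left_inverse tzero topp tadd.
Proof.
move=> x; apply: tensor_ext => W f bf.
by rewrite tlift_add // tlift_opp // tlift_zero // addNr.
Qed.

HB.instance Definition _ :=
  GRing.isZmodule.Build tensor taddA taddC tadd0 taddN.

Lemma tscaleA a b x : tscale a (tscale b x) = tscale (a * b) x.
Proof.
by apply: tensor_ext => W f bf; rewrite !tlift_scale // scalerA.
Qed.

Lemma tscale1 : left_id 1 tscale.
Proof.
by move=> x; apply: tensor_ext => W f bf; rewrite tlift_scale // scale1r.
Qed.

Lemma tscaleDr : right_distributive tscale +%R.
Proof.
move=> c x y; apply: tensor_ext => W f bf.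
by rewrite tlift_scale // !tlift_add // scalerDr !tlift_scale.
Qed.

Lemma tscaleDl x : {morph tscale^~ x : a b / a + b}.
Proof.
move=> a b; apply: tensor_ext => W f bf.
by rewrite tlift_add // !tlift_scale // scalerDl.
Qed.

HB.instance Definition _ :=
  GRing.Zmodule_isLmodule.Build K tensor tscaleA tscale1 tscaleDr tscaleDl.

Lemma tlift_linear (W : lmodType K) (f : U -> V -> W) : bilin f ->
  linear (tlift f).
Proof.
move=> bf c x y.
by rewrite (tlift_add _ _ bf : tlift f (c *: x + y) = _) (tlift_scale c x bf).
Qed.

Lemma tpure_bilin : bilin tpure.
Proof.
split=> [v c u u'|u c v v'] /=; apply: tensor_ext => W f bf;
  rewrite tlift_linear // !tlift_pure //.
- by rewrite (bilinDl bf) (bilinZl bf).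
- by rewrite (bilinDr bf) (bilinZr bf).
Qed.

End Tensor.

Section TensorAlgebra.
Variables (K : fieldType) (A B : algType K).

Definition tone : tensor A B := tpure 1 1.
Definition tmul (x y : tensor A B) : tensor A B :=
  tlift (fun a b => tlift (fun c d => tpure (a * c) (b * d)) y) x.

Lemma tmul_bilin_r (W : lmodType K) (f : A -> B -> W) a b : bilin f ->
  bilin (fun c d => f (a * c) (b * d)).
Proof.
move=> bf; split=> [d k c c'|c k d d'] /=.
- by rewrite mulrDr -scalerAr (bilinDl bf) (bilinZl bf).
- by rewrite mulrDr -scalerAr (bilinDr bf) (bilinZr bf).
Qed.

Lemma tmul_bilin_l (W : lmodType K) (f : A -> B -> W) y : bilin f ->
  bilin (fun a b => tlift (fun c d => f (a * c) (b * d)) y).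
Proof.
move=> bf; split=> [b k a a'|a k b b'] /=;
  rewrite /tlift /psum scaler_sumr -big_split /=; apply: eq_bigr => p _.
- by rewrite mulrDl -scalerAl (bilinDl bf) (bilinZl bf).
- by rewrite mulrDl -scalerAl (bilinDr bf) (bilinZr bf).
Qed.

Lemma tmul_pure a b c d :
  tmul (tpure a b) (tpure c d) = tpure (a * c) (b * d).
Proof.
have bp := @tpure_bilin K A B.
by rewrite /tmul tlift_pure ?tlift_pure //; [exact: tmul_bilin_r|exact: tmul_bilin_l].
Qed.

Lemma tmulDl : left_distributive tmul +%R.
Proof.
have bp := tmul_bilin_l _ (@tpure_bilin K A B).
by move=> x y z; have := tlift_linear (bp z) 1 x y; rewrite !scale1r.
Qed.

Lemma tmulZl k x y : k *: tmul x y = tmul (k *: x) y.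
Proof.
have bp := tmul_bilin_l _ (@tpure_bilin K A B).
by rewrite /tmul (tlift_scale k x (bp y)).
Qed.

Lemma tmulDr : right_distributive tmul +%R.
Proof.
have bp a b := tmul_bilin_r a b (@tpure_bilin K A B).
move=> x y z; rewrite /tmul /tlift /psum -big_split /=; apply: eq_bigr => p _.
by have := tlift_linear (bp p.1 p.2) 1 y z; rewrite !scale1r.
Qed.

Lemma tmulZr k x y : k *: tmul x y = tmul x (k *: y).
Proof.
have bp a b := tmul_bilin_r a b (@tpure_bilin K A B).
rewrite /tmul /tlift /psum scaler_sumr; apply: eq_bigr => p _.
by rewrite -(tlift_scale k y (bp p.1 p.2)).
Qed.

Lemma tensor_ind (P : tensor A B -> Prop) :
  P 0 -> (forall a b x, P x -> P (tpure a b + x)) -> forall x, P x.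
Proof.
move=> P0 PD x; rewrite -[x]reprK; elim: (repr x) => [//|[a b] s ih].
suff -> : \pi_(tensor A B) ((a, b) :: s) = tpure a b + \pi_(tensor A B) s.
  exact: PD.
apply: tensor_ext => W f bf.
by rewrite (tlift_add _ _ bf) tlift_pure // !tlift_pi // /psum big_cons.
Qed.

Lemma tmul0l x : tmul 0 x = 0.
Proof. by apply: (addrI (tmul 0 x)); rewrite -tmulDl !addr0. Qed.

Lemma tmul0r x : tmul x 0 = 0.
Proof. by apply: (addrI (tmul x 0)); rewrite -tmulDr !addr0. Qed.

Lemma tmulA : associative tmul.
Proof.
move=> x y z; elim/tensor_ind: x => [|a b x ih]; first by rewrite !tmul0l.
rewrite !tmulDl ih; congr (_ + _) => {ih}.
elim/tensor_ind: y => [|c d y ih]; first by rewrite tmul0l tmul0r tmul0l.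
rewrite !(tmulDl, tmulDr) ih; congr (_ + _) => {ih}.
elim/tensor_ind: z => [|e f z ih]; first by rewrite !tmul0r.
by rewrite !tmulDr ih !tmul_pure !mulrA.
Qed.

Lemma tmul1x : left_id tone tmul.
Proof.
elim/tensor_ind => [|a b x ih]; first by rewrite tmul0r.
by rewrite tmulDr ih tmul_pure !mul1r.
Qed.

Lemma tmulx1 : right_id tone tmul.
Proof.
elim/tensor_ind => [|a b x ih]; first by rewrite tmul0l.
by rewrite tmulDl ih tmul_pure !mulr1.
Qed.

Lemma tone_neq0 (f : A -> B -> K^o) : bilin f -> f 1 1 = 1 ->
  tone != 0 :> tensor A B.
Proof.
move=> bf f11; apply/eqP => /(congr1 (tlift f)).
rewrite tlift_pure // f11 (tlift_zero bf) => /eqP.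
by rewrite (negbTE (oner_neq0 _)).
Qed.

End TensorAlgebra.

(* Presentation of the enveloping algebra by the basis of the Lie algebra:
   expressions in the basis elements, modulo the axioms of unital K-algebras
   and the brackets. GD n stands for delta_(n+1). *)
Inductive H1gen := GX | GY | GD of nat.

Section H1.
Variable K : fieldType.

Inductive H1term :=
| TGen of H1gen
| TConst of K
| TAdd of H1term & H1term
| TMul of H1term & H1term.

HB.instance Definition _ := gen_eqMixin H1term.
HB.instance Definition _ := gen_choiceMixin H1term.

Definition TOpp t := TMul (TConst (-1)) t.
Definition TBrak s t := TAdd (TMul s t) (TOpp (TMul t s)).
Local Notation TX := (TGen GX).
Local Notation TY := (TGen GY).
Local Notation TD n := (TGen (GD n)).

Inductive H1cong : H1term -> H1term -> Prop :=
| CRefl t : H1cong t t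
| CSym s t : H1cong s t -> H1cong t s
| CTrans s t u : H1cong s t -> H1cong t u -> H1cong s u
| CAdd s s' t t' : H1cong s s' -> H1cong t t' -> H1cong (TAdd s t) (TAdd s' t')
| CMul s s' t t' : H1cong s s' -> H1cong t t' -> H1cong (TMul s t) (TMul s' t')
| CAddA s t u : H1cong (TAdd s (TAdd t u)) (TAdd (TAdd s t) u)
| CAddC s t : H1cong (TAdd s t) (TAdd t s)
| CAdd0 t : H1cong (TAdd (TConst 0) t) t
| CAddN t : H1cong (TAdd (TOpp t) t) (TConst 0)
| CMulA s t u : H1cong (TMul s (TMul t u)) (TMul (TMul s t) u)
| CMul1 t : H1cong (TMul (TConst 1) t) t
| CMulDl s t u : H1cong (TMul (TAdd s t) u) (TAdd (TMul s u) (TMul t u))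
| CMulDr s t u : H1cong (TMul s (TAdd t u)) (TAdd (TMul s t) (TMul s u))
| CConstD a b : H1cong (TConst (a + b)) (TAdd (TConst a) (TConst b))
| CConstM a b : H1cong (TConst (a * b)) (TMul (TConst a) (TConst b))
| CConstC a t : H1cong (TMul (TConst a) t) (TMul t (TConst a))
| CYX : H1cong (TBrak TY TX) TX
| CYD n : H1cong (TBrak TY (TD n)) (TMul (TConst n.+1%:R) (TD n))
| CXD n : H1cong (TBrak TX (TD n)) (TD n.+1)
| CDD k l : H1cong (TBrak (TD k) (TD l)) (TConst 0).

Definition H1rel (s t : H1term) : bool := `[< H1cong s t >].

Lemma H1relP s t : reflect (H1cong s t) (H1rel s t).
Proof. exact: asboolP. Qed.

Lemma H1rel_refl : reflexive H1rel.
Proof. by move=> s; apply/H1relP/CRefl. Qed.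

Lemma H1rel_sym : symmetric H1rel.
Proof. by move=> s t; apply/H1relP/H1relP; apply: CSym. Qed.

Lemma H1rel_trans : transitive H1rel.
Proof.
by move=> s t u /H1relP h1 /H1relP h2; apply/H1relP; apply: CTrans h1 h2.
Qed.

Definition H1_equiv := EquivRel H1rel H1rel_refl H1rel_sym H1rel_trans.

Definition H1 := {eq_quot H1_equiv}.
HB.instance Definition _ := Choice.on H1.
HB.instance Definition _ := EqQuotient.on H1.

Lemma H1_pi_eq s t : H1cong s t -> \pi_H1 s = \pi_H1 t.
Proof. by move=> h; apply/(@eqmodP _ H1_equiv)/H1relP. Qed.

Lemma H1_repr t : H1cong (repr (\pi_H1 t)) t.
Proof. by apply/H1relP; apply/(@eqmodP _ H1_equiv); rewrite reprK. Qed.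

Definition H1add (x y : H1) : H1 := \pi_H1 (TAdd (repr x) (repr y)).
Definition H1mul (x y : H1) : H1 := \pi_H1 (TMul (repr x) (repr y)).
Definition H1const (c : K) : H1 := \pi_H1 (TConst c).
Definition H1opp (x : H1) : H1 := H1mul (H1const (-1)) x.

Lemma H1addE s t : H1add (\pi_H1 s) (\pi_H1 t) = \pi_H1 (TAdd s t).
Proof. by apply: H1_pi_eq; apply: CAdd; apply: H1_repr. Qed.

Lemma H1mulE s t : H1mul (\pi_H1 s) (\pi_H1 t) = \pi_H1 (TMul s t).
Proof. by apply: H1_pi_eq; apply: CMul; apply: H1_repr. Qed.

Lemma H1P (P : H1 -> Prop) : (forall t, P (\pi_H1 t)) -> forall x, P x.
Proof. by move=> h x; rewrite -[x]reprK. Qed.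

Lemma H1addA : associative H1add.
Proof.
elim/H1P=> s; elim/H1P=> t; elim/H1P=> u.
by rewrite !H1addE; apply: H1_pi_eq; apply: CAddA.
Qed.

Lemma H1addC : commutative H1add.
Proof.
by elim/H1P=> s; elim/H1P=> t; rewrite !H1addE; apply/H1_pi_eq/CAddC.
Qed.

Lemma H1add0 : left_id (H1const 0) H1add.
Proof. by elim/H1P=> s; rewrite !H1addE; apply/H1_pi_eq/CAdd0. Qed.

Lemma H1addN : left_inverse (H1const 0) H1opp H1add.
Proof.
by elim/H1P=> s; rewrite /H1opp H1mulE H1addE; apply/H1_pi_eq/CAddN.
Qed.

HB.instance Definition _ := GRing.isZmodule.Build H1 H1addA H1addC H1add0 H1addN.

Lemma H1mulA : associative H1mul.
Proof.
elim/H1P=> s; elim/H1P=> t; elim/H1P=> u.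
by rewrite !H1mulE; apply: H1_pi_eq; apply: CMulA.
Qed.

Lemma H1mul1x : left_id (H1const 1) H1mul.
Proof. by elim/H1P=> s; rewrite !H1mulE; apply/H1_pi_eq/CMul1. Qed.

Lemma H1mulx1 : right_id (H1const 1) H1mul.
Proof.
elim/H1P=> s; rewrite !H1mulE; apply: H1_pi_eq.
by apply: CTrans (CMul1 s); apply/CSym/CConstC.
Qed.

Lemma H1mulDl : left_distributive H1mul +%R.
Proof.
elim/H1P=> s; elim/H1P=> t; elim/H1P=> u.
rewrite (H1addE s t : _ + _ = _) !H1mulE.
rewrite (H1addE (TMul s u) _ : _ + _ = _).
exact/H1_pi_eq/CMulDl.
Qed.

Lemma H1mulDr : right_distributive H1mul +%R.
Proof.
elim/H1P=> s; elim/H1P=> t; elim/H1P=> u.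
rewrite (H1addE t u : _ + _ = _) !H1mulE.
rewrite (H1addE (TMul s t) _ : _ + _ = _).
exact/H1_pi_eq/CMulDr.
Qed.

Section Eval.
Variables (B : algType K) (x y : B) (d : nat -> B).

Fixpoint H1eval (t : H1term) : B :=
  match t with
  | TGen GX => x
  | TGen GY => y
  | TGen (GD n) => d n
  | TConst c => c%:A
  | TAdd s t => H1eval s + H1eval t
  | TMul s t => H1eval s * H1eval t
  end.

Hypothesis hyx : y * x - x * y = x.
Hypothesis hyd : forall n, y * d n - d n * y = n.+1%:R * d n.
Hypothesis hxd : forall n, x * d n - d n * x = d n.+1.
Hypothesis hdd : forall k l, d k * d l = d l * d k.

Lemma H1eval_cong s t : H1cong s t -> H1eval s = H1eval t.
Proof.
elim=> //= {s t}.
- by move=> s t u _ -> _ ->.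
- by move=> s s' t t' _ -> _ ->.
- by move=> s s' t t' _ -> _ ->.
- by move=> s t u; rewrite addrA.
- by move=> s t; rewrite addrC.
- by move=> t; rewrite scale0r add0r.
- by move=> t; rewrite scaleN1r mulN1r addNr scale0r.
- by move=> s t u; rewrite mulrA.
- by move=> t; rewrite scale1r mul1r.
- by move=> s t u; rewrite mulrDl.
- by move=> s t u; rewrite mulrDr.
- by move=> a b; rewrite scalerDl.
- by move=> a b; rewrite -scalerAl mul1r scalerA.
- by move=> a t; rewrite -scalerAl -scalerAr mul1r mulr1.
- by rewrite scaleN1r mulN1r.
- by move=> n; rewrite scaleN1r mulN1r hyd scaler_nat.
- by move=> n; rewrite scaleN1r mulN1r hxd.
- by move=> k l; rewrite scaleN1r mulN1r hdd subrr scale0r.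
Qed.

End Eval.

Lemma H1one_neq0 : H1const 1 != 0.
Proof.
apply/eqP => /(@eqmodP _ H1_equiv) /H1relP.
have e0 (n : nat) : 0 * 0 - 0 * 0 = n.+1%:R * 0 :> K^o by rewrite !mulr0 subrr.
have e1 : 0 * 0 - 0 * 0 = 0 :> K^o by rewrite mulr0 subrr.
move/(@H1eval_cong K^o 0 0 (fun _ => 0) e1 e0 (fun _ => e1) (fun _ _ => erefl)).
by move=> /eqP /=; rewrite scale0r scale1r (negbTE (oner_neq0 _)).
Qed.

HB.instance Definition _ := GRing.Zmodule_isNzRing.Build H1
  H1mulA H1mul1x H1mulx1 H1mulDl H1mulDr H1one_neq0.

Definition H1scale (c : K) (h : H1) : H1 := H1const c * h.

Lemma H1constM a b : H1const (a * b) = H1const a * H1const b.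
Proof.
by rewrite (H1mulE (TConst a) _ : _ * _ = _); apply/H1_pi_eq/CConstM.
Qed.

Lemma H1constD a b : H1const (a + b) = H1const a + H1const b.
Proof.
by rewrite (H1addE (TConst a) _ : _ + _ = _); apply/H1_pi_eq/CConstD.
Qed.

Lemma H1constC a h : H1const a * h = h * H1const a.
Proof.
elim/H1P: h => t; rewrite (H1mulE (TConst a) _ : _ * _ = _).
by rewrite (H1mulE t _ : _ * H1const a = _); apply/H1_pi_eq/CConstC.
Qed.

Lemma H1scaleA a b h : H1scale a (H1scale b h) = H1scale (a * b) h.
Proof. by rewrite /H1scale mulrA -H1constM. Qed.

Lemma H1scale1 : left_id 1 H1scale.
Proof. by move=> h; rewrite /H1scale mul1r. Qed.

Lemma H1scaleDr : right_distributive H1scale +%R.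
Proof. by move=> c g h; rewrite /H1scale mulrDr. Qed.

Lemma H1scaleDl h : {morph H1scale^~ h : a b / a + b}.
Proof. by move=> a b; rewrite /H1scale H1constD mulrDl. Qed.

HB.instance Definition _ := GRing.Zmodule_isLmodule.Build K H1
  H1scaleA H1scale1 H1scaleDr H1scaleDl.

Lemma H1scaleAl c (g h : H1) : c *: (g * h) = (c *: g) * h.
Proof. exact: mulrA. Qed.

HB.instance Definition _ := GRing.Lmodule_isLalgebra.Build K H1 H1scaleAl.

Lemma H1scaleAr c (g h : H1) : c *: (g * h) = g * (c *: h).
Proof. by rewrite /(_ *: _) /= /H1scale mulrA H1constC mulrA. Qed.

HB.instance Definition _ := GRing.Lalgebra_isAlgebra.Build K H1 H1scaleAr.

Definition H1X : H1 := \pi_H1 (TGen GX).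
Definition H1Y : H1 := \pi_H1 (TGen GY).
(* H1delta n is delta_n for n >= 1; the value at n = 0 is irrelevant. *)
Definition H1delta (n : nat) : H1 := \pi_H1 (TGen (GD n.-1)).

Lemma H1_brakE s t :
  \pi_H1 s * \pi_H1 t - \pi_H1 t * \pi_H1 s = \pi_H1 (TBrak s t) :> H1.
Proof.
rewrite (H1mulE s t : _ * _ = _) (H1mulE t s : _ * _ = _).
rewrite /(- _) /= /H1opp /H1const H1mulE.
exact: H1addE.
Qed.

(* The defining brackets, for the sequence d with d n = delta_(n+1). *)
Record H1_brackets (B : algType K) (x y : B) (d : nat -> B) : Prop := {
  brak_yx : y * x - x * y = x;
  brak_yd : forall n, y * d n - d n * y = n.+1%:R * d n;
  brak_xd : forall n, x * d n - d n * x = d n.+1;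
  brak_dd : forall k l, d k * d l = d l * d k }.

Lemma H1constE c : H1const c = c%:A.
Proof. by rewrite /(_ *: _) /= /H1scale mulr1. Qed.

Lemma H1_relations : H1_brackets H1X H1Y (fun n => H1delta n.+1).
Proof.
split=> [|n|n|k l] /=; rewrite /H1X /H1Y /H1delta /=.
- by rewrite H1_brakE; apply/H1_pi_eq/CYX.
- rewrite H1_brakE (H1_pi_eq (CYD n)) -H1mulE -/(H1const _) H1constE.
  by rewrite scaler_nat.
- by rewrite H1_brakE; apply/H1_pi_eq/CXD.
- by apply/eqP; rewrite -subr_eq0 H1_brakE; apply/eqP/H1_pi_eq/CDD.
Qed.

(* The universal property of the enveloping algebra. *)
Section Lift.
Variables (B : algType K) (x y : B) (d : nat -> B).
Hypothesis r : H1_brackets x y d.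

Definition H1lift (_ : H1_brackets x y d) (h : H1) : B := H1eval x y d (repr h).

Lemma H1lift_pi t : H1lift r (\pi_H1 t) = H1eval x y d t.
Proof. by case: (r) => *; apply: H1eval_cong => //; apply: H1_repr. Qed.

Lemma H1liftM : monoid_morphism (H1lift r).
Proof.
split; first by rewrite [LHS]H1lift_pi /= scale1r.
elim/H1P=> s; elim/H1P=> t.
by rewrite (H1mulE s t : _ * _ = _) !H1lift_pi.
Qed.

Lemma H1liftL : linear (H1lift r).
Proof.
move=> c; elim/H1P=> s; elim/H1P=> t.
have -> : c *: \pi_H1 s = \pi_H1 (TMul (TConst c) s) :> H1.
  exact: (H1mulE (TConst c) s).
by rewrite (H1addE _ t : _ + _ = _) !H1lift_pi /= -scalerAl mul1r.
Qed.

End Lift.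

HB.instance Definition _ (B : algType K) x y d (r : @H1_brackets B x y d) :=
  GRing.isLinear.Build K H1 B _ (H1lift r) (H1liftL r).
HB.instance Definition _ (B : algType K) x y d (r : @H1_brackets B x y d) :=
  GRing.isMonoidMorphism.Build H1 B (H1lift r) (H1liftM r).

Lemma H1liftX (B : algType K) x y d (r : @H1_brackets B x y d) :
  H1lift r H1X = x.
Proof. exact: H1lift_pi. Qed.

Lemma H1liftY (B : algType K) x y d (r : @H1_brackets B x y d) :
  H1lift r H1Y = y.
Proof. exact: H1lift_pi. Qed.

Lemma H1lift_delta (B : algType K) x y d (r : @H1_brackets B x y d) n :
  H1lift r (H1delta n.+1) = d n.
Proof. exact: H1lift_pi. Qed.

Lemma H1_ind (P : H1 -> Prop) :
  P H1X -> P H1Y -> (forall n, P (H1delta n.+1)) -> (forall c, P c%:A) ->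
  (forall g h, P g -> P h -> P (g + h)) ->
  (forall g h, P g -> P h -> P (g * h)) ->
  forall h, P h.
Proof.
move=> pX pY pd pc pD pM; elim/H1P; elim=> [[| |n]|c|s ihs t iht|s ihs t iht] //.
- exact: (pd n).
- by rewrite -[\pi_H1 _]/(H1const c) H1constE.
- by rewrite -H1addE; apply: pD.
- by rewrite -H1mulE; apply: pM.
Qed.

Lemma H1counit_brackets : @H1_brackets K^o 0 0 (fun _ => 0).
Proof. by split=> *; rewrite ?mulr0 ?subrr. Qed.

Definition H1counit : H1 -> K^o := H1lift H1counit_brackets.
HB.instance Definition _ := GRing.LRMorphism.on H1counit.

Definition H1H1 := tensor H1 H1.
HB.instance Definition _ := GRing.Lmodule.on H1H1.

Lemma H1counit_bilin :
  @bilin K H1 H1 K^o (fun g h => H1counit g * H1counit h).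
Proof.
split=> [h c g g'|g c h h'] /=; rewrite linearP.
- by rewrite mulrDl scalerAl.
- by rewrite mulrDr scalerAr.
Qed.

Lemma H1H1_one_neq0 : tone H1 H1 != 0 :> H1H1.
Proof. by apply: (tone_neq0 H1counit_bilin); rewrite !rmorph1 mulr1. Qed.

HB.instance Definition _ := GRing.Zmodule_isNzRing.Build H1H1
  (@tmulA K H1 H1) (@tmul1x K H1 H1) (@tmulx1 K H1 H1)
  (@tmulDl K H1 H1) (@tmulDr K H1 H1) H1H1_one_neq0.
HB.instance Definition _ := GRing.Lmodule_isLalgebra.Build K H1H1
  (@tmulZl K H1 H1).
HB.instance Definition _ := GRing.Lalgebra_isAlgebra.Build K H1H1
  (@tmulZr K H1 H1).

Local Notation "g \ox h" := (tpure g h : H1H1) (at level 45).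
Local Notation X := H1X.
Local Notation Y := H1Y.
Local Notation delta := H1delta.

Lemma oxM a b c d : (a \ox b) * (c \ox d) = (a * c) \ox (b * d).
Proof. exact: tmul_pure. Qed.

Lemma oxDl a b c : (a + b) \ox c = a \ox c + b \ox c.
Proof. exact: (bilinDl (@tpure_bilin K H1 H1)). Qed.

Lemma oxDr a b c : a \ox (b + c) = a \ox b + a \ox c.
Proof. exact: (bilinDr (@tpure_bilin K H1 H1)). Qed.

Lemma ox0l a : 0 \ox a = 0.
Proof. exact: (bilin0l (@tpure_bilin K H1 H1)). Qed.

Lemma ox0r a : a \ox 0 = 0.
Proof. exact: (bilin0r (@tpure_bilin K H1 H1)). Qed.

Lemma oxNl a b : (- a) \ox b = - (a \ox b).
Proof.
by apply/eqP; rewrite -addr_eq0 -oxDl addNr ox0l.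
Qed.

Lemma oxNr a b : a \ox (- b) = - (a \ox b).
Proof.
by apply/eqP; rewrite -addr_eq0 -oxDr addNr ox0r.
Qed.

Definition DeltaX : H1H1 := X \ox 1 + 1 \ox X + delta 1 \ox Y.
Definition DeltaY : H1H1 := Y \ox 1 + 1 \ox Y.

(* Forced by delta_(n+1) = [X, delta_n]. *)
Fixpoint Deltad (n : nat) : H1H1 :=
  if n is m.+1 then DeltaX * Deltad m - Deltad m * DeltaX
  else delta 1 \ox 1 + 1 \ox delta 1.

Definition brak (B : algType K) (x y : B) : B := x * y - y * x.

Lemma brakDr (B : algType K) (x y z : B) : brak x (y + z) = brak x y + brak x z.
Proof. by rewrite /brak mulrDr mulrDl opprD addrACA. Qed.

Lemma brakDl (B : algType K) (x y z : B) : brak (x + y) z = brak x z + brak y z.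
Proof. by rewrite /brak mulrDr mulrDl opprD addrACA. Qed.

Lemma brakZr (B : algType K) c (x y : B) : brak x (c *: y) = c *: brak x y.
Proof. by rewrite /brak -scalerAr -scalerAl scalerBr. Qed.

Lemma brakMr (B : algType K) (x y z : B) :
  brak x (y * z) = brak x y * z + y * brak x z.
Proof. by rewrite /brak mulrBl mulrBr !mulrA addrA subrK. Qed.

Lemma brakN (B : algType K) (x y : B) : brak x (- y) = - brak x y.
Proof. by rewrite -scaleN1r brakZr scaleN1r. Qed.

Lemma brak_jacobi (B : algType K) (x y z : B) :
  brak x (brak y z) = brak (brak x y) z + brak y (brak x z).
Proof.
rewrite {2}/brak brakDr brakN !brakMr opprD.
by rewrite [- (_ * y) + _]addrC addrACA.
Qed.

(* The commutative subalgebra generated by the delta_n. *)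
Inductive inD : H1 -> Prop :=
| inD1 : inD 1
| inDd n : inD (delta n.+1)
| inDD g h : inD g -> inD h -> inD (g + h)
| inDZ c h : inD h -> inD (c *: h)
| inDM g h : inD g -> inD h -> inD (g * h).

Lemma inD_comm g h : inD g -> inD h -> g * h = h * g.
Proof.
move=> Dg; elim=> [|n|g1 h1 _ e1 _ e2|c h1 _ e1|g1 h1 _ e1 _ e2].
- by rewrite mulr1 mul1r.
- elim: Dg => [|m|g1 h1 _ e1 _ e2|c h1 _ e1|g1 h1 _ e1 _ e2].
  + by rewrite mulr1 mul1r.
  + exact: (brak_dd H1_relations).
  + by rewrite mulrDl mulrDr e1 e2.
  + by rewrite -scalerAl -scalerAr e1.
  + by rewrite -mulrA e2 !mulrA e1.
- by rewrite mulrDl mulrDr e1 e2.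
- by rewrite -scalerAl -scalerAr e1.
- by rewrite mulrA e1 -!mulrA e2.
Qed.

Lemma inD0 : inD 0.
Proof. by rewrite -(scale0r 1); apply/inDZ/inD1. Qed.

Lemma inD_der (x : H1) : (forall n, inD (brak x (delta n.+1))) ->
  forall h, inD h -> inD (brak x h).
Proof.
move=> xd h; elim=> [|n|g1 h1 _ e1 _ e2|c h1 _ e1|g1 h1 D1 e1 D2 e2] //.
- by rewrite /brak mulr1 mul1r subrr; exact: inD0.
- by rewrite brakDr; apply: inDD.
- by rewrite brakZr; apply: inDZ.
- by rewrite brakMr; apply: inDD; apply: inDM.
Qed.

Lemma inD_brakX h : inD h -> inD (brak X h).
Proof.
by apply: inD_der => n; rewrite [brak _ _](brak_xd H1_relations); apply: inDd.
Qed.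

Lemma inD_brakY h : inD h -> inD (brak Y h).
Proof.
apply: inD_der => n; rewrite [brak _ _](brak_yd H1_relations).
by rewrite mulr_natl -scaler_nat; apply/inDZ/inDd.
Qed.

Inductive inDD2 : H1H1 -> Prop :=
| inDD2p g h : inD g -> inD h -> inDD2 (g \ox h)
| inDD2D s t : inDD2 s -> inDD2 t -> inDD2 (s + t).

Lemma inDD2_comm s t : inDD2 s -> inDD2 t -> s * t = t * s.
Proof.
move=> Ds; elim=> [g h Dg Dh|t1 t2 _ e1 _ e2]; last first.
  by rewrite mulrDl mulrDr e1 e2.
elim: Ds => [g1 h1 Dg1 Dh1|t1 t2 _ e1 _ e2]; last first.
  by rewrite mulrDl mulrDr e1 e2.
by rewrite !oxM (inD_comm Dg1) // (inD_comm Dh1).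
Qed.

Lemma brak_ox a b g h :
  a * g = g * a -> brak (a \ox b) (g \ox h) = (a * g) \ox brak b h.
Proof. by move=> e; rewrite /brak !oxM e oxDr oxNr. Qed.

Lemma brak_oxl b g h : brak (b \ox 1) (g \ox h) = brak b g \ox h.
Proof. by rewrite /brak !oxM mul1r mulr1 oxDl oxNl. Qed.

Lemma brak_oxr b g h : brak (1 \ox b) (g \ox h) = g \ox brak b h.
Proof. by rewrite brak_ox mul1r ?mulr1. Qed.

Lemma inDD2_brakX t : inDD2 t -> inDD2 (brak DeltaX t).
Proof.
elim=> [g h Dg Dh|t1 t2 _ e1 _ e2]; last by rewrite brakDr; apply: inDD2D.
rewrite /DeltaX !brakDl brak_oxl brak_oxr brak_ox; last first.
  by apply: inD_comm => //; apply: inDd.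
apply: inDD2D; first apply: inDD2D; apply: inDD2p => //.
- exact: inD_brakX.
- exact: inD_brakX.
- by apply: inDM => //; apply: inDd.
- exact: inD_brakY.
Qed.

Lemma inDD2_Deltad n : inDD2 (Deltad n).
Proof.
elim: n => [|n ih] /=; last exact: inDD2_brakX.
by apply: inDD2D; apply: inDD2p; (exact: inD1 || exact: inDd).
Qed.

Lemma brak_DeltaYX : brak DeltaY DeltaX = DeltaX.
Proof.
have yx : brak Y X = X := brak_yx H1_relations.
have yd : brak Y (delta 1) = delta 1.
  by rewrite [brak _ _](brak_yd H1_relations 0) mul1r.
have b1 (h : H1) : brak h 1 = 0 by rewrite /brak mulr1 mul1r subrr.
have bb (h : H1) : brak h h = 0 by rewrite /brak subrr.
rewrite /DeltaX /DeltaY !brakDr !brakDl !brak_oxl !brak_oxr.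
by rewrite yx yd !b1 bb !ox0r !ox0l !addr0 !add0r.
Qed.

Lemma brak_DeltaYd n : brak DeltaY (Deltad n) = n.+1%:R * Deltad n.
Proof.
elim: n => [|n ih].
  have yd : brak Y (delta 1) = delta 1.
    by rewrite [brak _ _](brak_yd H1_relations 0) mul1r.
  have b1 (h : H1) : brak h 1 = 0 by rewrite /brak mulr1 mul1r subrr.
  rewrite /= /DeltaY !brakDr !brakDl !brak_oxl !brak_oxr.
  by rewrite yd !b1 !ox0r !ox0l !addr0 !add0r mul1r.
rewrite /= -/(brak DeltaX (Deltad n)) brak_jacobi brak_DeltaYX ih.
by rewrite !mulr_natl -scaler_nat brakZr scaler_nat -mulrS.
Qed.

Lemma Delta_brackets : H1_brackets DeltaX DeltaY Deltad.
Proof.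
split=> [|n|//|k l].
- exact: brak_DeltaYX.
- exact: brak_DeltaYd.
- by apply: inDD2_comm; apply: inDD2_Deltad.
Qed.

Definition Delta : H1 -> H1H1 := H1lift Delta_brackets.
HB.instance Definition _ := GRing.LRMorphism.on Delta.

Lemma Delta_X : Delta X = X \ox 1 + 1 \ox X + delta 1 \ox Y.
Proof. exact: H1liftX. Qed.

Lemma Delta_Y : Delta Y = Y \ox 1 + 1 \ox Y.
Proof. exact: H1liftY. Qed.

Lemma Delta_delta1 : Delta (delta 1) = delta 1 \ox 1 + 1 \ox delta 1.
Proof. exact: (H1lift_delta Delta_brackets 0). Qed.

Lemma H1counit_X : H1counit X = 0.
Proof. exact: H1liftX. Qed.

Lemma H1counit_Y : H1counit Y = 0.
Proof. exact: H1liftY. Qed.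

Lemma H1counit_delta n : H1counit (delta n.+1) = 0.
Proof. exact: (H1lift_delta H1counit_brackets n). Qed.

End H1.

Arguments H1X {K}.
Arguments H1Y {K}.
Arguments H1delta {K} n.

(* In the formulas below tlift f (Delta h) is the Sweedler sum of
   f h_(1) h_(2), every f being bilinear. *)
Section Actions.
Variables (K : fieldType) (A : algType K).

Local Notation H := (H1 K).

(* S(X) for the antipode S. *)
Definition H1SX : H := - H1X + H1delta 1 * H1Y.

Definition H1delta2' : H := H1delta 2 - 2%:R^-1 *: H1delta 1 ^+ 2.

Record H1_action (act : H -> A -> A) : Prop := {
  act_bilin : bilin act;
  act1 : forall a, act 1 a = a;
  actM : forall g h a, act (g * h) a = act g (act h a);
  act_mul : forall h a b,
    act h (a * b) = tlift (fun h1 h2 => act h1 a * act h2 b) (Delta h);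
  act_one : forall h, act h 1 = (H1counit h)%:A }.

Definition conv (f g : H -> A) (h : H) : A :=
  tlift (fun h1 h2 => f h1 * g h2) (Delta h).

Definition conv_inverse (f g : H -> A) : Prop :=
  (forall h, conv f g h = (H1counit h)%:A) /\
  (forall h, conv g f h = (H1counit h)%:A).

Definition cocycle1 (act : H -> A -> A) (gamma : {linear H -> A}) : Prop :=
  (exists gammai : {linear H -> A}, conv_inverse gamma gammai) /\
  (forall h h', gamma (h * h') =
     tlift (fun h1 h2 => gamma h1 * act h2 (gamma h')) (Delta h)).

Definition inner_perturbation (act : H -> A -> A) (gamma gammai : H -> A)
    (h : H) (a : A) : A :=
  tlift (fun h1 h23 =>
    tlift (fun h2 h3 => gamma h1 * act h2 a * gammai h3) (Delta h23)) (Delta h).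

(* alpha (alpha + 1) ... (alpha + m - 1) for an operator alpha. *)
Fixpoint op_poch (alpha : A -> A) (m : nat) (a : A) : A :=
  if m is m'.+1 then op_poch alpha m' (alpha a + m'%:R *: a) else a.

(* (2 Y + k)_m *)
Definition Ypoch (act : H -> A -> A) (k m : nat) : A -> A :=
  op_poch (fun a => 2%:R *: act H1Y a + k%:R *: a) m.

(* With n = n'.+1 in the recursion, (n - 1) / 2 = n' / 2. *)
Fixpoint opB (act : H -> A -> A) (Omega : A) (n : nat) (a : A) : A :=
  match n with
  | 0%N => a
  | 1%N => act H1X a
  | (n'.+1 as n1).+1 =>
      let b := opB act Omega n' a in
      act H1X (opB act Omega n1 a)
        - n1%:R *: (Omega * (act H1Y b - (n'%:R / 2%:R) *: b))
  end.

Fixpoint opA (act : H -> A -> A) (Omega : A) (n : nat) (a : A) : A :=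
  match n with
  | 0%N => a
  | 1%N => act H1SX a
  | (n'.+1 as n1).+1 =>
      let b := opA act Omega n' a in
      act H1SX (opA act Omega n1 a)
        - n1%:R *: ((act H1Y b - (n'%:R / 2%:R) *: b) * Omega)
  end.

Definition RC (act : H -> A -> A) (Omega : A) (n : nat) (a b : A) : A :=
  \sum_(k < n.+1)
     ((k`!%:R^-1 : K) *: opA act Omega k (Ypoch act k (n - k) a)) *
     (((n - k)`!%:R^-1 : K) *:
        opB act Omega (n - k) (Ypoch act (n - k) k b)).

End Actions.
Arguments H1SX {K}.
Arguments H1delta2' {K}.

(* Main.v *)
From HB Require Import structures.
Require Import Defs.
From mathcomp Require Import all_boot all_algebra.
From mathcomp Require Import reals complex.

(** Write [nu = mu / 2].  The inner perturbation keeps [Y] and replaces [X] by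
    [X + L_mu Y] and [S(X)] by [S(X) - R_mu Y].  The operators [B_n] of the
    perturbed action, computed with [Omega + X(mu) + mu^2 / 2], are binomial
    combinations of the old ones,
      [B'_n = \sum_k 'C(n, k) nu^(n-k) B_k (2Y + k)_(n-k)],
    and symmetrically
      [A'_n = \sum_k 'C(n, k) (A_k (2Y + k)_(n-k)) (- nu)^(n-k)],
    the powers of [- nu] acting by right multiplication.  Since
    [(2Y + p)_(k-p) (2Y + k)_(n-k) = (2Y + p)_(n-p)], substituting both in
    [RC_n] leaves, between [A_p] applied to [a] and [B_q] applied to [b], the
    factor [\sum_(i + j = n-p-q) (- nu)^i / i! * nu^j / j!], a coefficient of
    [e^(- t nu) e^(t nu) = 1] ([divpow_cancel]).  Only the terms with
    [p + q = n] survive, and they form the unperturbed bracket.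

    The two expansions are instances of one identity, [qrec_gauge], about
    operators [x], [y], [nu], [xi], [om] on a vector space satisfying
    [[y,x] = x], [[y,nu] = nu], [[y,om] = 2 om], [[x,nu] = xi] with [nu]
    commuting with [xi] and [om]: the three-term recursion attached to [x] and
    [om] is compared with the one attached to [x + 2 nu y] and
    [om + 2 xi + 2 nu^2].  For [B] these operators are [X], [Y] and left
    multiplications; for [A] they are [S(X)], [Y] and right multiplications,
    with [nu] replaced by [- nu].

    The commutation relations that involve [mu] come from the cocycle.
    [Y(mu) = mu] follows by applying [gamma] to
    [Y delta_1 = delta_1 Y + delta_1].  [X(mu)] commutes with [mu] because
    [delta_1] and [delta_2] commute: [gamma] sends [delta_1 delta_2] to
    [mu (X(mu) + mu^2)] and [delta_2 delta_1] to [(X(mu) + mu^2) mu].  Finally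
    [Omega mu - mu Omega = delta_2'(mu) = 0]. *)

Set Implicit Arguments.
Unset Strict Implicit.
Unset Printing Implicit Defensive.
Import GRing.Theory Num.Theory.
Local Open Scope ring_scope.

(** * Sums weighted by binomial coefficients *)

Section BinomialSums.
Variables (K : fieldType) (V : lmodType K).
Implicit Types c : nat -> V.

Lemma sum_bin_pascal m c :
  \sum_(k < m.+2) 'C(m.+1, k)%:R *: c k
  = \sum_(k < m.+1) 'C(m, k)%:R *: (c k.+1 + c k).
Proof.
under [RHS]eq_bigr do rewrite scalerDr.
rewrite big_split /= big_ord_recl [X in _ = _ + X]big_ord_recl !bin0 addrCA.
have step (k : 'I_m.+1) : 'C(m.+1, lift ord0 k)%:R *: c (lift ord0 k)
    = 'C(m, k.+1)%:R *: c k.+1 + 'C(m, k)%:R *: c k.+1.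
  by rewrite lift0 binS natrD scalerDl.
rewrite (eq_bigr _ (fun k _ => step k)) big_split big_ord_recr /=.
by rewrite bin_small // scale0r addr0 [X in _ = _ + X]addrC.
Qed.

Lemma sum_bin_diag n c :
  \sum_(k < n.+2) 'C(n.+1, k)%:R *: (k%:R *: c k)
  = n.+1%:R *: \sum_(k < n.+1) 'C(n, k)%:R *: c k.+1.
Proof.
rewrite big_ord_recl scale0r scaler0 add0r scaler_sumr.
by apply: eq_bigr => k _; rewrite !scalerA -!natrM mulnC -mul_bin_diag.
Qed.

Lemma sum_bin_down n c :
  \sum_(k < n.+2) 'C(n.+1, k)%:R *: ((n.+1 - k)%N%:R *: c k)
  = n.+1%:R *: \sum_(k < n.+1) 'C(n, k)%:R *: c k.
Proof.
rewrite big_ord_recr /= subnn scale0r scaler0 addr0 scaler_sumr.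
by apply: eq_bigr => k _; rewrite !scalerA -!natrM mulnC -mul_bin_down.
Qed.

End BinomialSums.

(** * Rising factorials and the three-term recursion *)

Section Rising.
Variables (K : fieldType) (V : lmodType K).

(** The operator [2 y + c], that is [weight + c] when [y] is half the weight. *)
Definition shiftw (y : V -> V) (c : nat) (v : V) : V :=
  2%:R *: y v + c%:R *: v.

(** The operator [(2 y + k)_m]. *)
Fixpoint rising (y : V -> V) (k m : nat) (v : V) : V :=
  if m is m'.+1 then rising y k m' (shiftw y (k + m')%N v) else v.

(** The recursion common to the operators [B_n] and [A_n]: the former are the
    case where [om] is left multiplication by the quadratic differential, the
    latter the case where it is right multiplication and [x] is [S(X)]. *)
Fixpoint qrec (x y om : V -> V) (n : nat) (v : V) : V :=
  match n with
  | 0%N => v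
  | 1%N => x v
  | (n'.+1 as n1).+1 =>
      let b := qrec x y om n' v in
      x (qrec x y om n1 v)
        - n1%:R *: om (y b - (n'%:R / 2%:R) *: b)
  end.

Lemma qrecSS x y om n v : qrec x y om n.+2 v =
  x (qrec x y om n.+1 v) -
    n.+1%:R *: om (y (qrec x y om n v) - (n%:R / 2%:R) *: qrec x y om n v).
Proof. by []. Qed.

Lemma eq_qrec x x' y y' om om' : x =1 x' -> y =1 y' -> om =1 om' ->
  forall n, qrec x y om n =1 qrec x' y' om' n.
Proof.
move=> ex ey eo n v.
suff [] : qrec x y om n v = qrec x' y' om' n v /\
          qrec x y om n.+1 v = qrec x' y' om' n.+1 v by [].
by elim: n => [|n [e1 e2]]; split => //; rewrite !qrecSS e1 e2 ex ey eo.
Qed.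

Variable y : {linear V -> V}.
Local Notation w := (shiftw y).

Lemma shiftw_is_linear c : linear (w c).
Proof.
move=> a u v; rewrite /shiftw linearP !scalerDr !scalerA addrACA.
by rewrite [_ * a]mulrC [_ * a]mulrC.
Qed.
HB.instance Definition _ c :=
  GRing.isLinear.Build K V V *:%R (w c) (shiftw_is_linear c).

Lemma shiftw_add c u v : w c (u + v) = w c u + w c v.
Proof. exact: linearD. Qed.

Lemma shiftw_scale c a v : w c (a *: v) = a *: w c v.
Proof. exact: linearZZ. Qed.

Lemma shiftwD c d v : w (c + d)%N v = w c v + d%:R *: v.
Proof. by rewrite /shiftw natrD (scalerDl v) addrA. Qed.

(** [f] raises the [y]-degree by [d], hence the weight [2 y] by [2 d]. *)
Lemma shiftw_comm (f : {linear V -> V}) d :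
  (forall v, y (f v) = f (y v + d%:R *: v)) ->
  forall c v, w c (f v) = f (w (c + d.*2)%N v).
Proof.
move=> yf c v; rewrite shiftwD /shiftw yf -!(linearZZ f) -(linearD f).
congr (f _).
by rewrite scalerDr scalerA addrAC -mul2n natrM.
Qed.

Lemma y_shiftw c v : y (w c v) = w c (y v).
Proof. by rewrite /shiftw linearD !linearZ. Qed.

Lemma shiftwC c d v : w c (w d v) = w d (w c v).
Proof.
rewrite (@shiftw_comm (w d) 0) ?addn0 // => u.
by rewrite scale0r addr0 y_shiftw.
Qed.

Lemma rising_is_linear k m : linear (rising y k m).
Proof. by elim: m => [//|m ih] a u v; rewrite /= linearP ih. Qed.
HB.instance Definition _ k m :=
  GRing.isLinear.Build K V V *:%R (rising y k m) (rising_is_linear k m).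

Lemma rising_add k m u v :
  rising y k m (u + v) = rising y k m u + rising y k m v.
Proof. exact: linearD. Qed.

Lemma rising_scale k m a v : rising y k m (a *: v) = a *: rising y k m v.
Proof. exact: linearZZ. Qed.

Lemma shiftw_rising c k m v : w c (rising y k m v) = rising y k m (w c v).
Proof. by elim: m v => [//|m ih] v; rewrite /= ih shiftwC. Qed.

Lemma risingSr k m v : rising y k m.+1 v = rising y k m (w (k + m)%N v).
Proof. by []. Qed.

Lemma risingD k i j v :
  rising y k (i + j)%N v = rising y k i (rising y (k + i)%N j v).
Proof.
elim: j v => [|j ih] v; first by rewrite addn0.
by rewrite addnS /= ih addnA.
Qed.

Lemma risingSl k m v : rising y k m.+1 v = rising y k.+1 m (w k v).
Proof. by rewrite -add1n risingD addn1 -shiftw_rising /= addn0. Qed.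
End Rising.

(** * Changing the recursion by a multiplication operator *)

Section Gauge.
Variables (K : numFieldType) (V : lmodType K) (x y nu xi om : {linear V -> V}).
Hypothesis yx : forall v, y (x v) = x (y v + v).
Hypothesis y_nu : forall v, y (nu v) = nu (y v + v).
Hypothesis y_om : forall v, y (om v) = om (y v + 2%:R *: v).
Hypothesis x_nu : forall v, x (nu v) = nu (x v) + xi v.
Hypothesis xi_nu : forall v, xi (nu v) = nu (xi v).
Hypothesis om_nu : forall v, om (nu v) = nu (om v).

Local Notation w := (shiftw y).
Local Notation B := (qrec x y om).
Local Notation nuX i := (iter i nu).
Local Notation P := (rising y).

Lemma nuX_is_linear i : linear (nuX i).
Proof. by elim: i => [//|i ih] a u v; rewrite /= ih linearP. Qed.
HB.instance Definition _ i :=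
  GRing.isLinear.Build K V V *:%R (nuX i) (nuX_is_linear i).

Lemma nuX_add i u v : nuX i (u + v) = nuX i u + nuX i v.
Proof. exact: linearD. Qed.

Lemma nuX_scale i a v : nuX i (a *: v) = a *: nuX i v.
Proof. exact: linearZZ. Qed.

Lemma qrec_is_linear n : linear (B n).
Proof.
suff [] : linear (B n) /\ linear (B n.+1) by [].
elim: n => [|n [l0 l1]]; split=> // a u v; first exact: linearP.
have e c (s t s' t' : V) :
    a *: s + t - c *: (a *: s' + t') = a *: (s - c *: s') + (t - c *: t').
  by rewrite scalerBr scalerDr !scalerA mulrC opprD addrACA.
by rewrite !qrecSS l0 l1 (linearP x) (linearP y) e (linearP om) e.
Qed.
HB.instance Definition _ n :=
  GRing.isLinear.Build K V V *:%R (B n) (qrec_is_linear n).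

Lemma qrec_add n u v : B n (u + v) = B n u + B n v.
Proof. exact: linearD. Qed.

Lemma qrec_scale n a v : B n (a *: v) = a *: B n v.
Proof. exact: linearZZ. Qed.

(** On the image of [B_n] the operator [y - n/2] of the recursion is half of
    [2 y + n] acting before [B_n].  The hypothesis is [y_qrec] at [n], whose
    proof by induction uses this form of the recursion. *)
Lemma y_qrec_half n v : y (B n v) = B n (y v + n%:R *: v) ->
  y (B n v) - (n%:R / 2%:R) *: B n v = 2%:R^-1 *: B n (w n v).
Proof.
move=> ->; rewrite /shiftw !qrec_add !qrec_scale scalerDr !scalerA.
rewrite mulVf ?pnatr_eq0 // scale1r -addrA -scalerBl; congr (_ + _ *: _).
by rewrite {1}[n%:R]splitr addrK mulrC.
Qed.

(** [B_n] has degree [n] for [y]: both terms of the recursion do, since [x] has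
    degree 1 and [om] degree 2. *)
Lemma y_qrec n v : y (B n v) = B n (y v + n%:R *: v).
Proof.
suff [] : y (B n v) = B n (y v + n%:R *: v) /\
  y (B n.+1 v) = B n.+1 (y v + n.+1%:R *: v) by [].
elim: n v => [|n ih] v; split.
- by rewrite scale0r addr0.
- by rewrite /= scale1r yx.
- exact: (ih v).2.
have half u := y_qrec_half (ih u).1.
rewrite !qrecSS !half linearB (linearZZ y) yx y_om (linearZZ y) (ih v).2.
rewrite (ih _).1 y_shiftw.
have -> : B n.+1 (y v + n.+1%:R *: v) + B n.+1 v
    = B n.+1 (y v + n.+2%:R *: v).
  by rewrite -qrec_add -addrA -[X in _ + (_ + X)]scale1r -scalerDl natr1.
have -> : w n (y v + n.+2%:R *: v) = w n (y v) + n%:R *: w n v + 2%:R *: w n v.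
  by rewrite shiftw_add shiftw_scale -[RHS]addrA -[in RHS]scalerDl -natrD addn2.
by rewrite [in RHS]qrec_add qrec_scale [in RHS]scalerDr scalerA mulrC -scalerA.
Qed.

Lemma shiftw_qrec c n v : w c (B n v) = B n (w (c + n.*2)%N v).
Proof. by apply: shiftw_comm => u; apply: y_qrec. Qed.

(** The recursion solved for [x B_k]; the junk value [B k.-1] at [k = 0] is
    multiplied by zero. *)
Lemma x_qrec k v : x (B k v) =
  B k.+1 v + k%:R *: (2%:R^-1 *: om (B k.-1 (w k.-1 v))).
Proof.
case: k => [|k]; first by rewrite scale0r addr0.
by rewrite qrecSS y_qrec_half ?y_qrec // (linearZZ om) subrK.
Qed.

Lemma x_nuX i v : x (nuX i v) = nuX i (x v) + i%:R *: xi (nuX i.-1 v).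
Proof.
elim: i => [|i ih]; first by rewrite scale0r addr0.
rewrite /= x_nu ih linearD linearZZ -addrA; congr (_ + _).
case: i {ih} => [|i] /=; first by rewrite scale0r add0r scale1r.
by rewrite -xi_nu -[i.+2%:R]natr1 (scalerDl _ i.+1%:R) scale1r.
Qed.

Lemma y_nuX i v : y (nuX i v) = nuX i (y v + i%:R *: v).
Proof.
elim: i v => [|i ih] v; first by rewrite scale0r addr0.
by rewrite iterSr ih y_nu -linearZZ -linearD /= -addrA -natr1 scalerDl scale1r
  [_ + v]addrC -iterSr.
Qed.

Lemma shiftw_nuX c i v : w c (nuX i v) = nuX i (w (c + i.*2)%N v).
Proof. by apply: shiftw_comm => u; apply: y_nuX. Qed.

Lemma om_nuX i v : om (nuX i v) = nuX i (om v).
Proof. by elim: i => //= i ih; rewrite om_nu ih. Qed.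

(** The operator [nu^i B_k (2 y + k)_j], with [i] and [j] independent because
    the recursion produces terms with [j = i], [i + 1] and [i - 1]. *)
Definition gauge_term i k j v := nuX i (B k (P k j v)).
Local Notation G := gauge_term.

Definition gauge_sum n v :=
  \sum_(k < n.+1) 'C(n, k)%:R *: G (n - k) k (n - k) v.

Local Notation x' := (fun v => x v + 2%:R *: nu (y v)).
Local Notation om' := (fun v => om v + 2%:R *: xi v + 2%:R *: nu (nu v)).

(** [(2y + k)_j] and [(2y + k+1)_j] differ by [j (2y + k+1)_(j-1)]: this
    replaces the rising factorial fitted to [B_k] by the one fitted to
    [B_(k+1)]. *)
Lemma nuX_qrecS m k v : (k <= m)%N ->
  nuX (m - k) (B k.+1 (P k (m - k) v)) =
  G (m - k) k.+1 (m - k) v - (m - k)%N%:R *: G (m - k) k.+1 (m - k.+1) v.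
Proof.
rewrite /gauge_term subnS => le_km; case e : (m - k)%N => [|j].
  by rewrite scale0r subr0.
have -> : P k.+1 j.+1 v = P k j.+1 v + j.+1%:R *: P k.+1 j v.
  rewrite risingSr risingSl addSnnS -e subnKC // -{1}(subnKC le_km) e.
  by rewrite shiftwD rising_add rising_scale.
by rewrite qrec_add qrec_scale nuX_add nuX_scale addrK.
Qed.

(** Moved to the right of [nu^(m-k) B_k], the operator [2 y] becomes
    [2 y + 2 m]; its part [2 y + m] extends the rising factorial by one factor
    and the other [m] gives the correction. *)
Lemma y_gauge_term m k v : (k <= m)%N ->
  2%:R *: nu (y (G (m - k) k (m - k) v)) =
  G (m.+1 - k) k (m.+1 - k) v + m%:R *: G (m.+1 - k) k (m - k) v.
Proof.
move=> le_km; set u := G _ _ _ _.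
have -> : 2%:R *: nu (y u) = nu (w 0 u).
  by rewrite /shiftw scale0r addr0 linearZZ.
rewrite shiftw_nuX shiftw_qrec add0n -doubleD subnK // -addnn shiftwD.
rewrite qrec_add qrec_scale nuX_add nuX_scale.
rewrite linearD linearZZ shiftw_rising -[X in w X v](subnKC le_km) -risingSr.
by rewrite subSn.
Qed.

(** The image of one term of [gauge_sum m] under [x + 2 nu y].  The bracketed
    pair will sum to [gauge_sum m.+1] by the Pascal rule; the [xi] and [om]
    parts and the last correction will cancel against the second term of the
    recursion. *)
Lemma x_gauge_term m k v : (k <= m)%N ->
  x' (G (m - k) k (m - k) v) =
    (m - k)%N%:R *: xi (G (m - k).-1 k (m - k) v)
    + k%:R *: (2%:R^-1 *: om (nuX (m - k) (B k.-1 (w k.-1 (P k (m - k) v)))))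
    + (G (m - k) k.+1 (m - k) v + G (m.+1 - k) k (m.+1 - k) v)
    + (m%:R *: G (m.+1 - k) k (m - k) v
       - (m - k)%N%:R *: G (m - k) k.+1 (m - k.+1) v).
Proof.
move=> le_km /=; rewrite y_gauge_term // x_nuX x_qrec nuX_add !nuX_scale.
rewrite -om_nuX nuX_qrecS //.
rewrite [_ + _ *: xi _]addrC -!addrA; congr (_ + _).
by rewrite [LHS]addrCA [LHS]addrA -addrA [LHS]addrC -!addrA addrCA.
Qed.

(** Every term of [gauge_sum n] has degree [n] for [y], so [y - n/2] adds the
    factor [2 y + n] to its rising factorial, as for [B_n] itself. *)
Lemma gauge_sum_shiftw n v :
  y (gauge_sum n v) - (n%:R / 2%:R) *: gauge_sum n v = 2%:R^-1 *:
    \sum_(k < n.+1) 'C(n, k)%:R *: G (n - k) k (n.+1 - k) v.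
Proof.
rewrite linear_sum !scaler_sumr -sumrB; apply: eq_bigr => k _.
have le_kn : (k <= n)%N by rewrite -ltnS.
rewrite /gauge_term subSn // risingSr subnKC // -shiftw_rising.
set u := P k (n - k) v.
have half (t : V) : y t - (n%:R / 2%:R) *: t = 2%:R^-1 *: (w 0 t - n%:R *: t).
  rewrite /shiftw scale0r addr0 scalerBr !scalerA mulVf ?pnatr_eq0 // scale1r.
  by rewrite mulrC.
rewrite linearZZ scalerA mulrC -scalerA -scalerBr half scalerA mulrC -scalerA.
congr (_ *: (_ *: _)); rewrite shiftw_nuX shiftw_qrec add0n -doubleD subnK //.
by rewrite -addnn shiftwD qrec_add qrec_scale nuX_add nuX_scale addrK.
Qed.

(** At [m = 0] the factor [m%:R] removes the meaningless second term, so one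
    formula covers all steps of the recursion. *)
Lemma gauge_sum_rec m v : gauge_sum m.+1 v = x' (gauge_sum m v) -
  m%:R *: om' (y (gauge_sum m.-1 v) - (m.-1%:R / 2%:R) *: gauge_sum m.-1 v).
Proof.
case: m => [|n].
  rewrite scale0r subr0 /gauge_sum big_ord_recl !big_ord1 /gauge_term /=.
  by rewrite !scale1r /shiftw scale0r addr0 linearZZ addrC.
rewrite gauge_sum_shiftw /=.
set S := \sum_(k < _) _.
have xS : x' (gauge_sum n.+1 v) =
   \sum_(k < n.+2) 'C(n.+1, k)%:R *: x' (G (n.+1 - k) k (n.+1 - k) v).
  rewrite /gauge_sum (linear_sum x) (linear_sum y) (linear_sum nu) /=.
  rewrite scaler_sumr -big_split; apply: eq_bigr => k _.
  rewrite (linearZZ x) (linearZZ y) (linearZZ nu) scalerDr.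
  by rewrite !scalerA [_ * 2%:R]mulrC.
have {xS} -> : x' (gauge_sum n.+1 v) = n.+1%:R *: xi S
    + n.+1%:R *: (2%:R^-1 *: om S) + gauge_sum n.+2 v + n.+1%:R *: nu (nu S).
  rewrite {}xS; under eq_bigr => k _.
    rewrite x_gauge_term; last by rewrite -ltnS.
    rewrite 3!scalerDr; over.
  rewrite !big_split /=; congr (_ + _ + _ + _).
  - rewrite (sum_bin_down n (fun k => xi (G (n.+1 - k).-1 k (n.+1 - k) v))).
    rewrite (linear_sum xi); congr (_ *: _); apply: eq_bigr => k _.
    by rewrite subSn -1?ltnS //= (linearZZ xi).
  - rewrite (sum_bin_diag n (fun k => 2%:R^-1 *: om (nuX (n.+1 - k)
      (B k.-1 (w k.-1 (P k (n.+1 - k) v)))))).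
    rewrite (linear_sum om) [X in _ = _ *: X]scaler_sumr; congr (_ *: _).
    apply: eq_bigr => k _.
    rewrite subSS /gauge_term /= shiftw_rising -risingSl -subSn -1?ltnS //.
    by rewrite (linearZZ om) !scalerA mulrC.
  - exact/esym/(sum_bin_pascal _ (fun k => G (n.+2 - k) k (n.+2 - k) v)).
  (* Split m = k + (m - k): the part in k cancels the shifted correction, and
     the part in m - k is the term nu^2 S. *)
  pose c k := G (n.+2 - k) k (n.+1 - k) v.
  under eq_bigr => k _.
    rewrite -[in X in X *: G _ _ _ _ - _](subnKC (_ : k <= n.+1)%N) -1?ltnS //.
    rewrite natrD scalerDl addrAC scalerDr scalerBr; over.
  rewrite big_split sumrB /= (sum_bin_diag n c).
  rewrite (sum_bin_down n (fun k => c k.+1)) subrr add0r.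
  rewrite (sum_bin_down n c) (linear_sum nu) (linear_sum nu).
  congr (_ *: _); apply: eq_bigr => k _.
  have le_kn : (k <= n)%N by rewrite -ltnS.
  by rewrite /c !(linearZZ nu) /gauge_term !subSn // leqW.
rewrite (linearZZ om) (linearZZ xi) !(linearZZ nu).
rewrite !(scalerA 2%:R) mulfV ?pnatr_eq0 // !scale1r !scalerDr.
by rewrite [X in _ = _ - (X + _)]addrC [X in _ = X - _]addrAC
  [_ + gauge_sum _ _]addrC addrK.
Qed.

(** Both sides satisfy the recursion of [x'] and [om'] ([gauge_sum_rec]) and
    start from the identity. *)
Theorem qrec_gauge n v : qrec x' y om' n v = gauge_sum n v.
Proof.
have base : gauge_sum 0 v = v by rewrite /gauge_sum big_ord1 scale1r.
suff [] : qrec x' y om' n v = gauge_sum n v /\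
  qrec x' y om' n.+1 v = gauge_sum n.+1 v by [].
elim: n => [|n [e0 e1]]; split=> //.
- by rewrite gauge_sum_rec base scale0r subr0.
- by rewrite qrecSS e0 e1 (gauge_sum_rec n.+1).
Qed.

End Gauge.

(** * Cancellation of the exponential factors *)

Section Expansions.
Variables (K : numFieldType) (A : algType K).

Definition divpow (u : A) (i : nat) : A := i`!%:R^-1 *: u ^+ i.

Lemma fact_binE n k : (k <= n)%N ->
  n`!%:R^-1 * 'C(n, k)%:R = k`!%:R^-1 * (n - k)`!%:R^-1 :> K.
Proof.
move=> le_kn; rewrite -(bin_fact le_kn) !natrM !invfM mulrAC mulVf ?mul1r //.
by rewrite pnatr_eq0 -lt0n bin_gt0.
Qed.

(** The binomial expansion of [(u - u)^m / m!]. *)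
Lemma divpow_sum_opp (u : A) m :
  \sum_(j < m.+1) divpow (- u) j * divpow u (m - j) = (m == 0%N)%:R.
Proof.
transitivity (m`!%:R^-1 *: (u + - u) ^+ m); last first.
  by rewrite subrr expr0n; case: m => [|m]; rewrite ?invr1 ?scale1r ?scaler0.
rewrite (exprDn_comm _ (commrN (commr_refl u))) scaler_sumr.
apply: eq_bigr => j _; have le_jm : (j <= m)%N by rewrite -ltnS.
rewrite /divpow -scalerAl -scalerAr scalerA -[in RHS]scaler_nat scalerA.
rewrite [in LHS](commrX _ (commr_sym (commrX _ (commrN (commr_refl u))))).
by rewrite fact_binE.
Qed.

(** Associativity applied to the [n]-th coefficient of the product of four
    series, [\sum_p a_p t^p], [e^(- t u)], [e^(t u)] and [\sum_q b_q t^q], the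
    middle two being inverse to each other.  Truncation at degree [n] makes them
    polynomials and does not affect the coefficients involved. *)
Lemma divpow_cancel (u : A) (a b : nat -> A) n :
  \sum_(k < n.+1)
    (\sum_(p < k.+1) a p * divpow (- u) (k - p)) *
    (\sum_(q < (n - k).+1) divpow u (n - k - q) * b q)
  = \sum_(k < n.+1) a k * b (n - k)%N.
Proof.
pose gen (f : nat -> A) : {poly A} := \poly_(i < n.+1) f i.
have genE f i : (i <= n)%N -> (gen f)`_i = f i.
  by move=> le_in; rewrite coef_poly ltnS le_in.
have coef_gen f g i : (i <= n)%N ->
    (gen f * gen g)`_i = \sum_(j < i.+1) f j * g (i - j)%N.
  move=> le_in; rewrite coefM; apply: eq_bigr => j _.
  have le_ji : (j <= i)%N by rewrite -ltnS.
  by rewrite !genE ?(leq_trans le_ji) // (leq_trans (leq_subr _ _)).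
transitivity ((gen a * gen (divpow (- u)) * (gen (divpow u) * gen b))`_n).
  rewrite coefM; apply: eq_bigr => k _.
  have le_kn : (k <= n)%N by rewrite -ltnS.
  rewrite !coef_gen ?leq_subr //; congr (_ * _).
  rewrite [RHS](reindex_inj rev_ord_inj) /=; apply: eq_bigr => q _.
  by rewrite subSS subKn // -ltnS.
rewrite -mulrA (mulrA (gen (divpow (- u)))) coefM; apply: eq_bigr => k _.
have le_kn : (k <= n)%N by rewrite -ltnS.
rewrite genE //; congr (_ * _); rewrite coefM big_ord_recl.
rewrite coef_gen // divpow_sum_opp mul1r subn0 genE ?leq_subr //.
rewrite big1 ?addr0 // => j _; rewrite lift0 coef_gen; last first.
  by rewrite (leq_trans (ltn_ord j)) ?leq_subr.
by rewrite divpow_sum_opp mul0r.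
Qed.
End Expansions.

(** * Convolution products on the generators *)

Section Sweedler.
Variables (K : fieldType) (A : algType K).
Local Notation H := (H1 K).
Local Notation d1 := (H1delta 1 : H).

Lemma bilin_mul (f g : H -> A) : linear f -> linear g ->
  bilin (fun h1 h2 => f h1 * g h2).
Proof.
move=> lf lg; split=> [h c u v|h c u v] /=.
- by rewrite lf mulrDl scalerAl.
- by rewrite lg mulrDr scalerAr.
Qed.

Lemma tliftD (W : lmodType K) (f : H -> H -> W) (s t : H1H1 K) : bilin f ->
  tlift f (s + t) = tlift f s + tlift f t.
Proof. exact: tlift_add. Qed.

Lemma tlift_Delta_linear (W : lmodType K) (f : H -> H -> W) : bilin f ->
  linear (fun h => tlift f (Delta h)).
Proof.
move=> bf c g h; rewrite linearP.
exact: (tlift_linear bf).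
Qed.

(** Needed because [S(X) = - X + delta_1 Y]. *)
Lemma Delta_delta1Y : Delta (d1 * H1Y) =
  tpure (d1 * H1Y) 1 + tpure d1 H1Y + (tpure H1Y d1 + tpure 1 (d1 * H1Y))
  :> H1H1 K.
Proof.
rewrite rmorphM /= Delta_delta1 Delta_Y mulrDl !mulrDr !oxM !mulr1 !mul1r.
by [].
Qed.

Section Conv.
Variables (f g : H -> A) (lf : linear f) (lg : linear g).
Let bfg := bilin_mul lf lg.

Lemma conv_is_linear : linear (conv f g).
Proof. exact: tlift_Delta_linear. Qed.

Lemma conv1 : conv f g 1 = f 1 * g 1.
Proof. by rewrite /conv rmorph1 tlift_pure. Qed.

Lemma conv_X : conv f g H1X = f H1X * g 1 + f 1 * g H1X + f d1 * g H1Y.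
Proof. by rewrite /conv Delta_X !tliftD ?tlift_pure. Qed.

Lemma conv_Y : conv f g H1Y = f H1Y * g 1 + f 1 * g H1Y.
Proof. by rewrite /conv Delta_Y !tliftD ?tlift_pure. Qed.

Lemma conv_delta1 : conv f g d1 = f d1 * g 1 + f 1 * g d1.
Proof. by rewrite /conv Delta_delta1 !tliftD ?tlift_pure. Qed.

Lemma conv_delta1Y : conv f g (d1 * H1Y) =
  f (d1 * H1Y) * g 1 + f d1 * g H1Y + (f H1Y * g d1 + f 1 * g (d1 * H1Y)).
Proof. by rewrite /conv Delta_delta1Y !tliftD ?tlift_pure. Qed.

(** The coproduct of [S(X)] has the correction term [Y \ox delta_1]: the
    antipode reverses the order of the factors in the term [delta_1 \ox Y] of
    the coproduct of [X]. *)
Lemma conv_SX : conv f g H1SX =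
  f H1SX * g 1 + f 1 * g H1SX + f H1Y * g d1.
Proof.
have -> : H1SX = (-1) *: H1X + d1 * H1Y :> H by rewrite scaleN1r.
rewrite conv_is_linear conv_X conv_delta1Y lf lg !scaleN1r.
rewrite mulrDl mulrDr mulNr mulrN [f (_ * _) * _ + _]addrC -[X in _ + X]addrA.
rewrite opprD [LHS]addrA subrK opprD [f H1Y * _ + _]addrC [X in _ + X]addrA.
by rewrite addrA addrACA.
Qed.
End Conv.
End Sweedler.

(** * The recursions of the brackets *)

Section Multiplications.
Variables (K : fieldType) (A : algType K).

Definition lmult (u v : A) : A := u * v.
Definition rmult (u v : A) : A := v * u.

Lemma lmult_is_linear u : linear (lmult u).
Proof. by move=> c v v'; rewrite /lmult mulrDr scalerAr. Qed.
HB.instance Definition _ u :=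
  GRing.isLinear.Build K A A *:%R (lmult u) (lmult_is_linear u).

Lemma rmult_is_linear u : linear (rmult u).
Proof. by move=> c v v'; rewrite /rmult mulrDl scalerAl. Qed.
HB.instance Definition _ u :=
  GRing.isLinear.Build K A A *:%R (rmult u) (rmult_is_linear u).

Lemma iter_lmult u i v : iter i (lmult u) v = u ^+ i * v.
Proof. by elim: i => [|i ih]; rewrite ?mul1r //= ih exprS /lmult mulrA. Qed.

Lemma iter_rmult u i v : iter i (rmult u) v = v * u ^+ i.
Proof. by elim: i => [|i ih]; rewrite ?mulr1 //= ih exprSr /rmult mulrA. Qed.

End Multiplications.

Section Recursions.
Variables (K : fieldType) (A : algType K) (f : H1 K -> A -> A) (Om : A).

Lemma opB_qrec n v : opB f Om n v = qrec (f H1X) (f H1Y) (lmult Om) n v.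
Proof.
suff [] : opB f Om n v = qrec (f H1X) (f H1Y) (lmult Om) n v /\
    opB f Om n.+1 v = qrec (f H1X) (f H1Y) (lmult Om) n.+1 v by [].
elim: n => [//|n [e0 e1]]; split=> //.
by rewrite qrecSS -e0 -e1.
Qed.

Lemma opA_qrec n v : opA f Om n v = qrec (f H1SX) (f H1Y) (rmult Om) n v.
Proof.
suff [] : opA f Om n v = qrec (f H1SX) (f H1Y) (rmult Om) n v /\
    opA f Om n.+1 v = qrec (f H1SX) (f H1Y) (rmult Om) n.+1 v by [].
elim: n => [//|n [e0 e1]]; split=> //.
by rewrite qrecSS -e0 -e1.
Qed.

Lemma YpochE y k m v : f H1Y =1 y ->
  Ypoch f k m v = rising y k m v.
Proof.
move=> e; rewrite /Ypoch; elim: m v => [//|m ih] v /=.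
by rewrite ih /shiftw e natrD (scalerDl v) addrA.
Qed.

End Recursions.

(** * The perturbed action and its brackets *)

Section Perturbation.
Variables (K : numFieldType) (A : algType K) (act : H1 K -> A -> A) (Omega : A).
Variables (gamma gammai : {linear H1 K -> A}).
Hypothesis act_action : H1_action act.
Hypothesis delta2'_inner : forall a, act H1delta2' a = Omega * a - a * Omega.
Hypothesis Y_Omega : act H1Y Omega = 2%:R *: Omega.
Hypothesis gamma_cocycle : cocycle1 act gamma.
Hypothesis gammai_inverse : conv_inverse gamma gammai.
Hypothesis gamma_X : gamma H1X = 0.
Hypothesis gamma_Y : gamma H1Y = 0.
Hypothesis delta_gamma :
  forall k h, (1 <= k)%N -> act (H1delta k) (gamma h) = 0.

Local Notation H := (H1 K).
Local Notation d1 := (H1delta 1 : H).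
Local Notation X := (H1X : H).
Local Notation Y := (H1Y : H).
Local Notation SX := (H1SX : H).
Local Notation mu := (gamma d1).
Local Notation act' := (inner_perturbation act gamma gammai).
Local Notation Omega' := (Omega + act X mu + 2%:R^-1 *: mu ^+ 2).

Lemma act_is_linear h : linear (act h).
Proof. exact: (act_bilin act_action).2. Qed.
HB.instance Definition _ h :=
  GRing.isLinear.Build K A A *:%R (act h) (act_is_linear h).

Lemma act_linear_l a : linear (act^~ a).
Proof. exact: (act_bilin act_action).1. Qed.

Lemma act_conv h a b : act h (a * b) = conv (act^~ a) (act^~ b) h.
Proof. exact: act_mul. Qed.

Lemma actD h a b : act h (a + b) = act h a + act h b.
Proof. exact: linearD. Qed.

Lemma actZ h c a : act h (c *: a) = c *: act h a.
Proof. exact: linearZZ. Qed.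

Lemma actN h a : act h (- a) = - act h a.
Proof. exact: linearN. Qed.

Lemma actDl g h a : act (g + h) a = act g a + act h a.
Proof. by have := act_linear_l a 1 g h; rewrite !scale1r. Qed.

Lemma actNl h a : act (- h) a = - act h a.
Proof.
apply/eqP; rewrite -addr_eq0 -actDl addNr -(scale0r 1).
by rewrite (bilinZl (act_bilin act_action)) scale0r.
Qed.

Lemma H1_YX : Y * X = X * Y + X.
Proof. by rewrite addrC; apply/(canRL (subrK _))/brak_yx/H1_relations. Qed.

Lemma H1_Yd1 : Y * d1 = d1 * Y + d1.
Proof.
rewrite addrC; apply/(canRL (subrK _)).
by rewrite (brak_yd (H1_relations K) 0) mul1r.
Qed.

Lemma H1_YSX : Y * SX = SX * Y + SX.
Proof.
rewrite /H1SX mulrDr mulrDl mulrN mulNr H1_YX mulrA H1_Yd1 mulrDl opprD.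
by rewrite addrACA.
Qed.

Lemma act_YX a : act Y (act X a) = act X (act Y a + a).
Proof. by rewrite -!(actM act_action) H1_YX actDl actD (actM act_action). Qed.

Lemma act_YSX a : act Y (act SX a) = act SX (act Y a + a).
Proof. by rewrite -!(actM act_action) H1_YSX actDl actD (actM act_action). Qed.

(** Both sides of [Y delta_1 = delta_1 Y + delta_1] are sent by [gamma]. *)
Lemma act_Y_mul a b : act Y (a * b) = act Y a * b + a * act Y b.
Proof.
by rewrite act_conv conv_Y ?(act1 act_action) //; exact: act_linear_l.
Qed.

Lemma act_X_mul a b :
  act X (a * b) = act X a * b + a * act X b + act d1 a * act Y b.
Proof.
by rewrite act_conv conv_X ?(act1 act_action) //; exact: act_linear_l.
Qed.

Lemma act_SX_mul a b :
  act SX (a * b) = act SX a * b + a * act SX b + act Y a * act d1 b.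
Proof.
by rewrite act_conv conv_SX ?(act1 act_action) //; exact: act_linear_l.
Qed.

Lemma gamma_mul h h' : gamma (h * h') = conv gamma (act^~ (gamma h')) h.
Proof. exact: gamma_cocycle.2. Qed.

(** The cocycle identity makes [gamma 1] idempotent, and convolution
    invertibility makes it invertible. *)
Lemma gamma1 : gamma 1 = 1.
Proof.
have g2 : gamma 1 * gamma 1 = gamma 1.
  rewrite -[in RHS](mulr1 1) gamma_mul conv1 ?(act1 act_action) //.
  - exact: linearP.
  - exact: act_linear_l.
have := gammai_inverse.1 1; rewrite conv1 ?rmorph1 ?scale1r; last first.
- exact: linearP.
- exact: linearP.
by move=> e; rewrite -[LHS]mulr1 -[in LHS]e mulrA g2 e.
Qed.

Lemma gammai1 : gammai 1 = 1.
Proof.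
have := gammai_inverse.1 1; rewrite conv1 ?rmorph1 ?scale1r ?gamma1 ?mul1r //.
- exact: linearP.
- exact: linearP.
Qed.

Lemma counit_eq0 h : H1counit h = 0 -> conv gamma gammai h = 0.
Proof. by move=> e; rewrite gammai_inverse.1 e scale0r. Qed.

Lemma gammai_Y : gammai Y = 0.
Proof.
have := counit_eq0 (H1counit_Y K).
by rewrite conv_Y ?gamma_Y ?gamma1 ?mul0r ?add0r ?mul1r //; apply: linearP.
Qed.

Lemma gammai_X : gammai X = 0.
Proof.
have := counit_eq0 (H1counit_X K); rewrite conv_X; try exact: linearP.
by rewrite gamma_X gammai_Y gamma1 mul0r add0r mul1r mulr0 addr0.
Qed.

Lemma gammai_d1 : gammai d1 = - mu.
Proof.
have := counit_eq0 (H1counit_delta K 0).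
rewrite conv_delta1; try exact: linearP.
by rewrite gamma1 gammai1 mul1r mulr1 addrC => /eqP; rewrite addr_eq0 => /eqP.
Qed.

Lemma gamma_d1_mul h : gamma (d1 * h) = mu * gamma h.
Proof.
rewrite gamma_mul conv_delta1; [|exact: linearP|exact: act_linear_l].
by rewrite (act1 act_action) delta_gamma // mulr0 addr0.
Qed.

Lemma gamma_X_mul h : gamma (X * h) = act X (gamma h) + mu * act Y (gamma h).
Proof.
rewrite gamma_mul conv_X; [|exact: linearP|exact: act_linear_l].
by rewrite gamma_X gamma1 mul0r add0r mul1r.
Qed.

Lemma gamma_Y_mul h : gamma (Y * h) = act Y (gamma h).
Proof.
rewrite gamma_mul conv_Y; [|exact: linearP|exact: act_linear_l].
by rewrite gamma_Y gamma1 mul0r add0r mul1r.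
Qed.

Lemma gamma_d1Y : gamma (d1 * Y) = 0.
Proof. by rewrite gamma_d1_mul gamma_Y mulr0. Qed.

Lemma gammai_d1Y : gammai (d1 * Y) = 0.
Proof.
have : conv gamma gammai (d1 * Y) = 0.
  by rewrite counit_eq0 // rmorphM /= H1counit_Y mulr0.
rewrite conv_delta1Y; try exact: linearP.
by rewrite gamma_d1Y gammai_Y gamma_Y gamma1 !mul0r mulr0 !add0r mul1r.
Qed.

Lemma act_Y_mu : act Y mu = mu.
Proof. by rewrite -gamma_Y_mul H1_Yd1 linearD /= gamma_d1Y add0r. Qed.

Lemma act_d1_mu : act d1 mu = 0.
Proof. exact: delta_gamma. Qed.

Lemma act_SX_mu : act SX mu = - act X mu.
Proof. by rewrite actDl (actM act_action) act_Y_mu act_d1_mu addr0 actNl. Qed.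

(** This is [gamma] applied to [delta_1 delta_2 = delta_2 delta_1], where
    [delta_2 = X delta_1 - delta_1 X]; the cubic terms in [mu] agree. *)
Lemma act_X_mu_comm : act X mu * mu = mu * act X mu.
Proof.
have gX1 : gamma (X * d1) = act X mu + mu * mu by rewrite gamma_X_mul act_Y_mu.
have gX2 : gamma (X * (d1 * d1)) =
    act X mu * mu + mu * act X mu + mu * (mu * mu + mu * mu).
  rewrite gamma_X_mul gamma_d1_mul act_X_mul act_Y_mul act_d1_mu act_Y_mu.
  by rewrite mul0r addr0.
have := brak_dd (H1_relations K) 0 1; rewrite -(brak_xd (H1_relations K) 0).
move=> /(congr1 gamma); rewrite mulrBr mulrBl -!mulrA !linearB /= gX2.
rewrite !gamma_d1_mul gX1 gamma_X !mulr0 subr0 !mulrDr => /eqP.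
rewrite addrA eq_sym subr_eq -addrA addrACA !(inj_eq (addIr _)).
by move/eqP.
Qed.

Lemma Omega_mu_comm : Omega * mu = mu * Omega.
Proof.
apply/eqP; rewrite -subr_eq0 -delta2'_inner /H1delta2' actDl actNl.
rewrite (bilinZl (act_bilin act_action)) expr2 (actM act_action) act_d1_mu.
by rewrite linear0 delta_gamma // scaler0 subr0.
Qed.

(** The double Sweedler sum is an iterated convolution, so the perturbed
    generators follow from the convolution formulas applied twice. *)
Lemma perturb_convE h a : act' h a = conv gamma (conv (act^~ a) gammai) h.
Proof.
rewrite /inner_perturbation /conv /tlift /psum; apply: eq_bigr => p _.
by rewrite mulr_sumr; apply: eq_bigr => q _; rewrite mulrA.
Qed.

Lemma conv_act_linear a : linear (conv (act^~ a) gammai).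
Proof. by apply: conv_is_linear; [exact: act_linear_l|exact: linearP]. Qed.

Lemma perturb_Y a : act' Y a = act Y a.
Proof.
rewrite perturb_convE conv_Y; [|exact: linearP|exact: conv_act_linear].
rewrite gamma_Y gamma1 mul0r add0r mul1r.
rewrite conv_Y; [|exact: act_linear_l|exact: linearP].
by rewrite gammai_Y gammai1 mulr0 addr0 mulr1.
Qed.

Lemma perturb_X a : act' X a = act X a + mu * act Y a.
Proof.
have la := act_linear_l a; have lg : linear gammai by exact: linearP.
rewrite perturb_convE conv_X; [|exact: linearP|exact: conv_act_linear].
rewrite gamma_X gamma1 mul0r add0r mul1r conv_X // conv_Y //.
by rewrite gammai_X gammai_Y gammai1 !mulr0 !addr0 !mulr1.
Qed.

(** The term [mu Y] of the perturbed [delta_1 Y] cancels the one of the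
    perturbed [- X], which leaves only a right multiplication. *)
Lemma perturb_SX a : act' SX a = act SX a - act Y a * mu.
Proof.
have la := act_linear_l a; have lg : linear gammai by exact: linearP.
have lc := conv_act_linear a.
have -> : act' SX a = - act' X a + act' (d1 * Y) a.
  rewrite !perturb_convE -scaleN1r -conv_is_linear ?scaleN1r //; exact: linearP.
rewrite perturb_X perturb_convE conv_delta1Y;
  [|exact: linearP|exact: conv_act_linear].
rewrite gamma_d1Y gamma_Y gamma1 !mul0r mul1r !add0r conv_Y // conv_delta1Y //.
rewrite gammai_Y gammai1 gammai_d1Y gammai_d1.
rewrite !mulr0 !addr0 !mulr1 mulrN (actDl (- X)) actNl opprD addrA addrC.
by rewrite subrK addrC addrA.
Qed.

Local Notation nu := (2%:R^-1 *: mu).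

(** [qrec_gauge] for [x = X] and [nu = L_(mu/2)]; the correction [delta_1(nu) Y]
    in [X (nu u)] vanishes, so [[x, nu]] is left multiplication by
    [X(mu) / 2]. *)
Lemma opB_perturb n v : opB act' Omega' n v = \sum_(k < n.+1)
  'C(n, k)%:R *: (nu ^+ (n - k) * opB act Omega k (rising (act Y) k (n - k) v)).
Proof.
rewrite opB_qrec (eq_qrec (x' := fun u => act X u + 2%:R *: lmult nu (act Y u))
  (y' := act Y) (om' := fun u => lmult Omega u
     + 2%:R *: lmult (2%:R^-1 *: act X mu) u + 2%:R *: lmult nu (lmult nu u))).
- rewrite qrec_gauge.
  + by apply: eq_bigr => k _; rewrite /gauge_term iter_lmult opB_qrec.
  + exact: act_YX.
  + move=> u /=; rewrite /lmult act_Y_mul actZ act_Y_mu.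
    by rewrite -mulrDr addrC.
  + move=> u /=; rewrite /lmult act_Y_mul Y_Omega mulrDr addrC.
    by rewrite -scalerAl -scalerAr.
  + move=> u /=; rewrite /lmult act_X_mul !actZ act_d1_mu.
    by rewrite scaler0 mul0r addr0 addrC.
  + move=> u /=; rewrite /lmult !mulrA; congr (_ * _).
    by rewrite -!scalerAl -!scalerAr act_X_mu_comm.
  + move=> u /=; rewrite /lmult !mulrA; congr (_ * _).
    by rewrite -scalerAl -scalerAr Omega_mu_comm.
- move=> u; rewrite perturb_X /lmult.
  by rewrite -scalerAl scalerA mulfV ?pnatr_eq0 // scale1r.
- exact: perturb_Y.
- move=> u; rewrite /lmult !mulrDl -!scalerAl -!scalerAr !scalerA.
  by rewrite mulfV ?pnatr_eq0 // mul1r scale1r expr2 mulrA.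
Qed.

(** [qrec_gauge] for [x = S(X)] and [nu = R_(- mu/2)]; as [S(X)(mu) = - X(mu)],
    [[x, nu]] is right multiplication by [X(mu) / 2], with no sign. *)
Lemma opA_perturb n v : opA act' Omega' n v = \sum_(k < n.+1)
  'C(n, k)%:R *:
     (opA act Omega k (rising (act Y) k (n - k) v) * (- nu) ^+ (n - k)).
Proof.
rewrite opA_qrec (eq_qrec
  (x' := fun u => act SX u + 2%:R *: rmult (- nu) (act Y u))
  (y' := act Y) (om' := fun u => rmult Omega u
     + 2%:R *: rmult (2%:R^-1 *: act X mu) u
     + 2%:R *: rmult (- nu) (rmult (- nu) u))).
- rewrite qrec_gauge.
  + by apply: eq_bigr => k _; rewrite /gauge_term iter_rmult opA_qrec.
  + exact: act_YSX.
  + move=> u /=; rewrite /rmult act_Y_mul actN actZ act_Y_mu.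
    by rewrite -mulrDl.
  + move=> u /=; rewrite /rmult act_Y_mul Y_Omega mulrDl.
    by rewrite -scalerAl -scalerAr.
  + move=> u /=; rewrite /rmult act_SX_mul !actN !actZ act_d1_mu act_SX_mu.
    by rewrite scaler0 oppr0 mulr0 addr0 scalerN opprK.
  + move=> u /=; rewrite /rmult -!mulrA; congr (_ * _).
    by rewrite mulrN mulNr -!scalerAl -!scalerAr act_X_mu_comm.
  + move=> u /=; rewrite /rmult -!mulrA; congr (_ * _).
    by rewrite mulrN mulNr -scalerAl -scalerAr Omega_mu_comm.
- move=> u; rewrite perturb_SX /rmult.
  by rewrite mulrN -scalerAr scalerN scalerA mulfV ?pnatr_eq0 // scale1r.
- exact: perturb_Y.
- move=> u; rewrite /rmult !mulrDr -!mulrA mulrNN -!scalerAl -!scalerAr.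
  by rewrite !scalerA mulVKf ?mulfV ?pnatr_eq0 // scale1r expr2.
Qed.

Lemma RC_inner_perturbation n a b : RC act' Omega' n a b = RC act Omega n a b.
Proof.
pose alpha p := p`!%:R^-1 *: opA act Omega p (rising (act Y) p (n - p) a).
pose beta q := q`!%:R^-1 *: opB act Omega q (rising (act Y) q (n - q) b).
transitivity (\sum_(k < n.+1) alpha k * beta (n - k)%N); last first.
  apply: eq_bigr => k _; have le_kn : (k <= n)%N by rewrite -ltnS.
  by rewrite /alpha /beta !(YpochE (y := act Y)) // subKn.
rewrite -(divpow_cancel nu); apply: eq_bigr => k _.
have le_kn : (k <= n)%N by rewrite -ltnS.
rewrite !(YpochE _ _ _ perturb_Y) opA_perturb opB_perturb !scaler_sumr.
congr (_ * _); apply: eq_bigr => p _.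
- have le_pk : (p <= k)%N by rewrite -ltnS.
  rewrite scalerA fact_binE // /alpha /divpow -scalerAl -scalerAr scalerA.
  have -> : (n - p = (k - p) + (n - k))%N by rewrite addnC addnBA ?subnK.
  by rewrite risingD subnKC.
- have le_pk : (p <= n - k)%N by rewrite -ltnS.
  rewrite scalerA fact_binE // /beta /divpow -scalerAl -scalerAr scalerA mulrC.
  have -> : (n - p = (n - k - p) + k)%N.
    rewrite subnAC subnK // leq_subRL ?(leq_trans le_pk) ?leq_subr //.
    by rewrite addnC -leq_subRL.
  by rewrite risingD subnKC.
Qed.
End Perturbation.

Theorem lemma6 (R : realType) (A : algType R[i]) (act : H1 R[i] -> A -> A)
    (Omega : A) (gamma gammai : {linear H1 R[i] -> A})
    (act_action : H1_action act)
    (delta2'_inner : forall a : A, act H1delta2' a = Omega * a - a * Omega)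
    (delta_Omega : forall k : nat, (1 <= k)%N -> act (H1delta k) Omega = 0)
    (Y_Omega : act H1Y Omega = 2%:R *: Omega)
    (gamma_cocycle : cocycle1 act gamma)
    (gammai_inverse : conv_inverse gamma gammai)
    (gamma_X : gamma H1X = 0)
    (gamma_Y : gamma H1Y = 0)
    (delta_gamma : forall (k : nat) (h : H1 R[i]),
       (1 <= k)%N -> act (H1delta k) (gamma h) = 0) :
  let mu := gamma (H1delta 1) in
  forall (n : nat) (a b : A),
    RC (inner_perturbation act gamma gammai)
       (Omega + act H1X mu + 2%:R^-1 *: mu ^+ 2) n a b
    = RC act Omega n a b.
Proof. by move=> mu n a b; apply: RC_inner_perturbation. Qed.
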